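(* Let $m\in\mathbb{N}$ and let $V_n$ ($n\in\mathbb{N}$) and $V$ be 1-periodic complex-valued distributions in $H_{+}^{-m}$ such that $V_n\to V$ in $H_{+}^{-m}$ as $n\to\infty$. Then the operators $S_{\pm}^{(n)}:=S_{\pm}(V_n)$ converge to $S_{\pm}:=S_{\pm}(V)$ in the uniform resolvent sense: for $\lambda$ in the resolvent set of $S_\pm$, $$\|R(\lambda,S_{\pm}^{(n)})-R(\lambda,S_{\pm})\|\to0,\qquad n\to\infty.$$
   Context: For $s\in\mathbb{R}$, $H_{+}^{s}$ is the space of formal series $f=\sum_{k\in\mathbb{Z}}\widehat f(2k)e^{i2k\pi x}$ with $\|f\|_{H_+^s}^2=\sum_k\langle 2k\rangle^{2s}|\widehat f(2k)|^2<\infty$, and $H_{-}^{s}$ is the space of formal series $f=\sum_{k}\widehat f(2k+1)e^{i(2k+1)\pi x}$ with $\|f\|_{H_-^s}^2=\sum_k\langle 2k+1\rangle^{2s}|\widehat f(2k+1)|^2<\infty$, where $\langle k\rangle=1+|k|$; $H_\pm^0=L_2(0,1)$. $\langle\cdot,\cdot\rangle_{\pm}$ is the pairing between $H_\pm^{s}$ and $H_\pm^{-s}$ extending the $L_2(0,1)$ inner product. $D_{\pm}=-i\,d/dx$ on $H_\pm^1$, $D_\pm^{2m}=|D_\pm|^{2m}$ (multiplication by $(n\pi)^{2m}$ on the mode $e^{in\pi x}$). For $W\in H_+^{-m}$ and $u\in H_\pm^{m}$, $W(x)u=\sum_n\big(\sum_j\widehat W(n-j)\widehat u(j)\big)e^{in\pi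 x}\in H_\pm^{-m}$. For $W\in H_+^{-m}$, $S_{\pm}(W)=D_{\pm}^{2m}\dotplus W$ is the $m$-sectorial operator on $L_2(0,1)$ associated with the closed sectorial form $\langle D_{\pm}^{2m}u,v\rangle_{\pm}+\langle W(x)u,v\rangle_{\pm}$ on $H_\pm^m$; explicitly $\mathrm{Dom}(S_{\pm}(W))=\{u\in H_{\pm}^{m}\mid D_{\pm}^{2m}u+W(x)u\in L_{2}(0,1)\}$, $S_\pm(W)u=D_{\pm}^{2m}u+W(x)u$. $R(\lambda,A)=(A-\lambda I)^{-1}$ denotes the resolvent. *)

(* Defs.v *)
From Stdlib Require Import Reals ZArith.
From Coquelicot Require Import Coquelicot.
Open Scope R_scope.

(* A 1-periodic / 1-antiperiodic formal series is represented by its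
   coefficient sequence indexed by k : Z.  Sign [sg = true] is "+":
   the coefficient at index k is \hat f(2k); [sg = false] is "-":
   the coefficient at index k is \hat f(2k+1). *)
Definition fser := Z -> C.

(* the frequency n (mode e^{i n pi x}) carried by index k *)
Definition mode (sg : bool) (k : Z) : Z := (2 * k + if sg then 0 else 1)%Z.

Definition bracket (n : Z) : R := 1 + Rabs (IZR n).

Definition weight (sg : bool) (s : Z) (k : Z) : R :=
  powerRZ (bracket (mode sg k)) (2 * s).

(* a series over Z, arranged as a series over nat: g(j) + g(-j-1) *)
Definition zterm (g : Z -> R) (j : nat) : R :=
  g (Z.of_nat j) + g (- Z.of_nat j - 1)%Z.

Definition in_H (sg : bool) (s : Z) (f : fser) : Prop :=
  ex_series (zterm (fun k => weight sg s k * (Cmod (f k)) ^ 2)).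

Definition H_norm (sg : bool) (s : Z) (f : fser) : R :=
  sqrt (Series (zterm (fun k => weight sg s k * (Cmod (f k)) ^ 2))).

(* sum over Z of a complex family (used only for absolutely summable ones) *)
Definition zsumC (a : Z -> C) : C :=
  (Series (zterm (fun k => Re (a k))), Series (zterm (fun k => Im (a k)))).

Definition fsub (f g : fser) : fser := fun k => Cminus (f k) (g k).
Definition fscal (c : C) (f : fser) : fser := fun k => Cmult c (f k).

(* W(x) u, W \in H_+^{-m}: (Wu)^(n) = sum_j W^(n-j) u^(j);
   with n = 2k+d, j = 2i+d, n-j = 2(k-i). *)
Definition mult_op (W u : fser) : fser :=
  fun k => zsumC (fun i => Cmult (W (k - i)%Z) (u i)).

Definition Dpow (sg : bool) (m : nat) (u : fser) : fser :=
  fun k => Cmult (RtoC ((IZR (mode sg k) * PI) ^ (2 * m))) (u k).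

Definition S_op (sg : bool) (m : nat) (W u : fser) : fser :=
  fun k => Cplus (Dpow sg m u k) (mult_op W u k).

Definition S_dom (sg : bool) (m : nat) (W u : fser) : Prop :=
  in_H sg (Z.of_nat m) u /\ in_H sg 0 (S_op sg m W u).

(* R is the resolvent R(lambda, S_{sg}(W)) = (S - lambda I)^{-1}, a bounded
   operator on L_2(0,1) = H_{sg}^0; in particular lambda lies in the
   resolvent set of S_{sg}(W). *)
Definition is_resolvent (sg : bool) (m : nat) (W : fser) (lam : C)
    (Res : fser -> fser) : Prop :=
  (forall f, in_H sg 0 f ->
      S_dom sg m W (Res f) /\ fsub (S_op sg m W (Res f)) (fscal lam (Res f)) = f)
  /\ (forall u, S_dom sg m W u ->
      Res (fsub (S_op sg m W u) (fscal lam u)) = u)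
  /\ (exists M : R, forall f, in_H sg 0 f ->
      H_norm sg 0 (Res f) <= M * H_norm sg 0 f).

Definition opnorm_conv (sg : bool) (Rn : nat -> fser -> fser)
    (Res : fser -> fser) : Prop :=
  forall eps : R, 0 < eps -> exists N : nat, forall n : nat, (N <= n)%nat ->
    forall f, in_H sg 0 f ->
      H_norm sg 0 (fsub (Rn n f) (Res f)) <= eps * H_norm sg 0 f.

(* Main.v *)
Require Import Defs.
From Stdlib Require Import Reals ZArith.
From Coquelicot Require Import Coquelicot.
From Stdlib Require Import Lra Lia FunctionalExtensionality ClassicalEpsilon.
Open Scope R_scope.

(** Let [mu >= 1], [omega k = (n_k pi)^(2m) + mu], and let [X], [Y] be the l2 spaces with
    weights [omega] and [1 / omega]. Since [<n_k - n_i>^(2m) <= 16^m (omega k + omega i)],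
    multiplication by [W] is a Hilbert-Schmidt operator from [X] to [Y] whose squared norm is
    at most [2 * 16^m * |W|^2 * sum_k 1 / omega k]. As [mu] grows the last sum tends to 0, so
    for large [mu] the operator [D^(2m) + mu + V : X -> Y] is invertible by a Neumann series.
    Writing [S(V) - lam] as this operator minus a multiple of the identity, the L2 resolvent
    [Res] upgrades to a bounded inverse of [S(V) - lam : X -> Y]. Finally
    [S(V_n) - lam] differs from [S(V) - lam] by multiplication by [V_n - V], which is small from
    [X] to [Y], and a second Neumann series gives the resolvents and their convergence. *)

(** * Symmetric partial sums over Z *)

(** Multiplication by [V_n - V] need not be bounded on L2, so a bound on [Res] in L2 alone cannot
    absorb it. This forces the work between [X] and its dual [Y]. Because [omega >= 1], the
    inclusions of [X] in L2 and of L2 in [Y] have norm at most 1, and any bound from [Y] to [X] is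
    also a bound on L2. The shift [mu] is needed because the resolvent at [lam] comes with no
    estimate in [X]: the inverse of [D^(2m) + mu + V] supplies the missing regularity, and [Res]
    only corrects a multiple of the identity. Summability of [1 / omega] is where [m >= 1] enters:
    it gives at least quadratic growth. Estimates are made on finite symmetric sums, where
    reordering is plain algebra, and then passed to the limit. *)

Fixpoint box (g : Z -> R) (N : nat) : R :=
  match N with O => 0 | S N => box g N + zterm g N end.

Lemma sum_n_zterm (g : Z -> R) (N : nat) : sum_n (zterm g) N = box g (S N).
Proof.
  induction N as [|N IH].
  - rewrite sum_O; simpl; ring.
  - rewrite sum_Sn, IH; reflexivity.
Qed.

Lemma box_ext (f g : Z -> R) (N : nat) : (forall k, f k = g k) -> box f N = box g N.
Proof.
  intros H; induction N as [|N IH]; simpl; [reflexivity|].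
  unfold zterm; rewrite IH, !H; reflexivity.
Qed.

Lemma box_le (f g : Z -> R) (N : nat) : (forall k, f k <= g k) -> box f N <= box g N.
Proof.
  intros H; induction N as [|N IH]; simpl; [lra|].
  unfold zterm; pose proof (H (Z.of_nat N)); pose proof (H (- Z.of_nat N - 1)%Z); lra.
Qed.

Lemma box_plus (f g : Z -> R) (N : nat) : box (fun k => f k + g k) N = box f N + box g N.
Proof. induction N as [|N IH]; simpl; [ring|]. rewrite IH; unfold zterm; ring. Qed.

Lemma box_scal (c : R) (g : Z -> R) (N : nat) : box (fun k => c * g k) N = c * box g N.
Proof. induction N as [|N IH]; simpl; [ring|]. rewrite IH; unfold zterm; ring. Qed.

Lemma box_nonneg (g : Z -> R) (N : nat) : (forall k, 0 <= g k) -> 0 <= box g N.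
Proof.
  intros H; induction N as [|N IH]; simpl; [lra|].
  unfold zterm; pose proof (H (Z.of_nat N)); pose proof (H (- Z.of_nat N - 1)%Z); lra.
Qed.

Lemma box_swap (g : Z -> Z -> R) (N M : nat) :
  box (fun k => box (g k) M) N = box (fun i => box (fun k => g k i) N) M.
Proof.
  induction N as [|N IH]; simpl.
  - induction M as [|M IHM]; simpl; [ring|]. rewrite <- IHM; unfold zterm; ring.
  - rewrite IH; clear IH.
    induction M as [|M IHM]; simpl; [unfold zterm; simpl; ring|].
    rewrite <- IHM; unfold zterm; simpl; unfold zterm; ring.
Qed.

Lemma box_lim (g : nat -> Z -> R) (l : Z -> R) (N : nat) :
  (forall k, is_lim_seq (fun n => g n k) (l k)) ->
  is_lim_seq (fun n => box (g n) N) (box l N).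
Proof.
  intros H; induction N as [|N IH]; simpl; [apply is_lim_seq_const|].
  apply is_lim_seq_plus'; [exact IH|apply is_lim_seq_plus'; apply H].
Qed.

(** Symmetric boxes are not preserved by [i -> k - i] or [k -> k - i], the substitutions met in a
    convolution, whereas integer intervals are. *)
Fixpoint isum (g : Z -> R) (a : Z) (n : nat) : R :=
  match n with O => 0 | S n => isum g a n + g (a + Z.of_nat n)%Z end.

Lemma isum_add (g : Z -> R) (a : Z) (n p : nat) :
  isum g a (n + p) = isum g a n + isum g (a + Z.of_nat n) p.
Proof.
  induction p as [|p IH].
  - rewrite Nat.add_0_r; simpl; ring.
  - rewrite Nat.add_succ_r; simpl; rewrite IH.
    replace (a + Z.of_nat (n + p))%Z with (a + Z.of_nat n + Z.of_nat p)%Z by lia; ring.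
Qed.

Lemma isum_nonneg (g : Z -> R) (a : Z) (n : nat) : (forall k, 0 <= g k) -> 0 <= isum g a n.
Proof.
  intros H; induction n as [|n IH]; simpl; [lra|].
  pose proof (H (a + Z.of_nat n)%Z); lra.
Qed.

Lemma box_isum (g : Z -> R) (N : nat) : box g N = isum g (- Z.of_nat N) (N + N).
Proof.
  induction N as [|N IH]; [reflexivity|].
  replace (S N + S N)%nat with (1 + ((N + N) + 1))%nat by lia.
  rewrite isum_add, (isum_add _ _ (N + N) 1).
  replace (- Z.of_nat (S N) + Z.of_nat 1)%Z with (- Z.of_nat N)%Z by lia.
  rewrite <- IH; simpl box; unfold zterm; cbn [isum].
  replace (- Z.of_nat (S N) + Z.of_nat 0)%Z with (- Z.of_nat N - 1)%Z by lia.
  replace (- Z.of_nat N + Z.of_nat (N + N) + Z.of_nat 0)%Z with (Z.of_nat N) by lia.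
  ring.
Qed.

Lemma isum_le_box (g : Z -> R) (a : Z) (n : nat) :
  (forall k, 0 <= g k) -> exists K, isum g a n <= box g K.
Proof.
  intros H; exists (Z.to_nat (Z.abs a) + n)%nat.
  set (K := (Z.to_nat (Z.abs a) + n)%nat).
  rewrite box_isum.
  (* With [K = |a| + n] the interval starting at [a] lies in [[-K, K)]. The box is cut into the
     piece left of [a], the interval, and the remainder, so the truncated subtractions are exact. *)
  replace (K + K)%nat with (Z.to_nat (a + Z.of_nat K) + (n + (K + K - n - Z.to_nat (a + Z.of_nat K))))%nat by lia.
  rewrite isum_add, isum_add.
  replace (- Z.of_nat K + Z.of_nat (Z.to_nat (a + Z.of_nat K)))%Z with a by lia.
  pose proof (isum_nonneg g (- Z.of_nat K) (Z.to_nat (a + Z.of_nat K)) H).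
  pose proof (isum_nonneg g (a + Z.of_nat n) (K + K - n - Z.to_nat (a + Z.of_nat K)) H).
  lra.
Qed.

Lemma isum_reflect (g : Z -> R) (k a : Z) (n : nat) :
  isum (fun i => g (k - i)%Z) a n = isum g (k - a - Z.of_nat n + 1) n.
Proof.
  induction n as [|n IH]; [reflexivity|].
  replace (S n) with (1 + n)%nat at 3 by lia.
  rewrite isum_add; cbn [isum]; rewrite IH.
  replace (k - a - Z.of_nat (S n) + 1 + Z.of_nat 1)%Z with (k - a - Z.of_nat n + 1)%Z by lia.
  replace (k - a - Z.of_nat (S n) + 1 + Z.of_nat 0)%Z with (k - (a + Z.of_nat n))%Z by lia.
  ring.
Qed.

Lemma isum_shift (g : Z -> R) (i a : Z) (n : nat) :
  isum (fun k => g (k - i)%Z) a n = isum g (a - i) n.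
Proof.
  induction n as [|n IH]; simpl; [reflexivity|].
  rewrite IH; do 2 f_equal; lia.
Qed.

(** A reflected box is an interval, hence contained in a larger box; for nonnegative terms a bound
    uniform over boxes therefore survives. *)
Lemma box_reflect_le (g : Z -> R) (B : R) (k : Z) (N : nat) :
  (forall j, 0 <= g j) -> (forall K, box g K <= B) -> box (fun i => g (k - i)%Z) N <= B.
Proof.
  intros H HB; rewrite box_isum, isum_reflect.
  destruct (isum_le_box g (k - - Z.of_nat N - Z.of_nat (N + N) + 1) (N + N) H) as [K HK].
  specialize (HB K); lra.
Qed.

Lemma box_shift_le (g : Z -> R) (B : R) (i : Z) (N : nat) :
  (forall j, 0 <= g j) -> (forall K, box g K <= B) -> box (fun k => g (k - i)%Z) N <= B.
Proof.
  intros H HB; rewrite box_isum, isum_shift.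
  destruct (isum_le_box g (- Z.of_nat N - i) (N + N) H) as [K HK].
  specialize (HB K); lra.
Qed.

(** * Series over Z as limits of symmetric sums *)

Lemma is_series_box (g : Z -> R) (l : R) :
  is_series (zterm g) l <-> is_lim_seq (box g) l.
Proof.
  rewrite is_lim_seq_incr_1; split; intros H.
  - apply is_lim_seq_ext with (sum_n (zterm g)); [intros n; apply sum_n_zterm|exact H].
  - change (is_lim_seq (sum_n (zterm g)) l).
    apply is_lim_seq_ext with (fun n => box g (S n)); [intros n; symmetry; apply sum_n_zterm|exact H].
Qed.

Lemma Series_box (g : Z -> R) :
  ex_series (zterm g) -> is_lim_seq (box g) (Series (zterm g)).
Proof. intros H; apply is_series_box, Series_correct, H. Qed.

Lemma ex_series_box (g : Z -> R) (B : R) :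
  (forall k, 0 <= g k) -> (forall N, box g N <= B) -> ex_series (zterm g).
Proof.
  intros Hg HB.
  destruct (ex_finite_lim_seq_incr (box g) B) as [l Hl].
  - intros n; simpl; unfold zterm.
    pose proof (Hg (Z.of_nat n)); pose proof (Hg (- Z.of_nat n - 1)%Z); lra.
  - exact HB.
  - exists l; apply is_series_box, Hl.
Qed.

Lemma box_le_Series (g : Z -> R) (N : nat) :
  (forall k, 0 <= g k) -> ex_series (zterm g) -> box g N <= Series (zterm g).
Proof.
  intros Hg H.
  apply (is_lim_seq_incr_compare (box g)); [apply Series_box, H|].
  intros n; simpl; unfold zterm.
  pose proof (Hg (Z.of_nat n)); pose proof (Hg (- Z.of_nat n - 1)%Z); lra.
Qed.

Lemma Series_le_box (g : Z -> R) (B : R) :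
  ex_series (zterm g) -> (forall N, box g N <= B) -> Series (zterm g) <= B.
Proof.
  intros H HB.
  apply (is_lim_seq_le (box g) (fun _ => B) (Finite (Series (zterm g))) (Finite B)).
  - exact HB.
  - apply Series_box, H.
  - apply is_lim_seq_const.
Qed.

Lemma ex_series_zterm_le (f g : Z -> R) :
  (forall k, Rabs (f k) <= g k) -> ex_series (zterm g) -> ex_series (zterm f).
Proof.
  intros H Hg; apply (ex_series_le (zterm f) (zterm g)); [|exact Hg].
  intros n; unfold zterm, norm; simpl; unfold abs; simpl.
  eapply Rle_trans; [apply Rabs_triang|apply Rplus_le_compat; apply H].
Qed.

(** * Weighted l2 norms *)

(** A bound on all partial sums also encodes convergence, whereas the value of [Series] says nothing
    about a divergent series. The condition [0 <= b] lets squares be compared through [b]. *)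
Definition norm_le (w : Z -> R) (u : fser) (b : R) : Prop :=
  0 <= b /\ forall N, box (fun k => w k * Cmod (u k) ^ 2) N <= b ^ 2.

Definition fzero : fser := fun _ => 0%C.
Definition fadd (f g : fser) : fser := fun k => Cplus (f k) (g k).

(** Gives room for slack: Minkowski may divide by strictly positive bounds, and arbitrarily small
    bounds yield the bound 0. *)
Lemma norm_le_eps (w : Z -> R) (u : fser) (b : R) :
  (forall e, 0 < e -> norm_le w u (b + e)) -> norm_le w u b.
Proof.
  intros H.
  assert (Hb : 0 <= b) by (apply le_epsilon; intros e He; apply (H e He)).
  split; [exact Hb|]; intros N.
  apply (is_lim_seq_le (fun _ => box (fun k => w k * Cmod (u k) ^ 2) N)
    (fun n => (b + / (INR n + 1)) ^ 2)
    (Finite (box (fun k => w k * Cmod (u k) ^ 2) N)) (Finite (b ^ 2))).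
  - intros n; apply H; apply RinvN_pos.
  - apply is_lim_seq_const.
  - assert (L : is_lim_seq (fun n => b + / (INR n + 1)) (b + 0)).
    { apply is_lim_seq_plus'; [apply is_lim_seq_const|].
      apply is_lim_seq_ext with (fun n => / INR (S n)).
      { intros n; rewrite S_INR; reflexivity. }
      apply (is_lim_seq_incr_1 (fun n => / INR n)).
      apply (is_lim_seq_inv INR p_infty); [apply is_lim_seq_INR|discriminate]. }
    rewrite Rplus_0_r in L.
    replace (b ^ 2) with (b * b) by ring.
    apply is_lim_seq_ext with (fun n => (b + / (INR n + 1)) * (b + / (INR n + 1))).
    { intros n; ring. }
    apply is_lim_seq_mult'; exact L.
Qed.

Lemma norm_le_mono (w : Z -> R) (u : fser) (b b' : R) : b <= b' -> norm_le w u b -> norm_le w u b'.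
Proof.
  intros H [Hb Hu]; split; [lra|]; intros N; specialize (Hu N).
  pose proof (pow_incr b b' 2 (conj Hb H)); lra.
Qed.

Lemma norm_le_weight_le (w w' : Z -> R) (c : R) (u : fser) (b : R) :
  0 <= c -> (forall k, w k <= c ^ 2 * w' k) -> norm_le w' u b -> norm_le w u (c * b).
Proof.
  intros Hc H [Hb Hu]; split; [apply Rmult_le_pos; assumption|]; intros N.
  rewrite Rpow_mult_distr.
  apply Rle_trans with (c ^ 2 * box (fun k => w' k * Cmod (u k) ^ 2) N).
  - rewrite <- box_scal; apply box_le; intros k.
    rewrite <- Rmult_assoc; apply Rmult_le_compat_r; [apply pow2_ge_0|apply H].
  - apply Rmult_le_compat_l; [apply pow2_ge_0|apply Hu].
Qed.

Lemma norm_le_coef_le (w : Z -> R) (u v : fser) (c b : R) :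
  0 <= c -> (forall k, 0 <= w k) -> (forall k, Cmod (v k) <= c * Cmod (u k)) ->
  norm_le w u b -> norm_le w v (c * b).
Proof.
  intros Hc Hw H [Hb Hu]; split; [apply Rmult_le_pos; assumption|]; intros N.
  rewrite Rpow_mult_distr.
  apply Rle_trans with (c ^ 2 * box (fun k => w k * Cmod (u k) ^ 2) N).
  - rewrite <- box_scal; apply box_le; intros k.
    replace (c ^ 2 * (w k * Cmod (u k) ^ 2)) with (w k * (c * Cmod (u k)) ^ 2) by ring.
    apply Rmult_le_compat_l; [apply Hw|].
    apply pow_incr; split; [apply Cmod_ge_0|apply H].
  - apply Rmult_le_compat_l; [apply pow2_ge_0|apply Hu].
Qed.

(* Minkowski, from (x + y)^2 <= (a + b) (x^2 / a + y^2 / b) *)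
Lemma norm_le_bound_plus (w : Z -> R) (u v z : fser) (a b : R) :
  (forall k, 0 <= w k) -> (forall k, Cmod (z k) <= Cmod (u k) + Cmod (v k)) ->
  norm_le w u a -> norm_le w v b -> norm_le w z (a + b).
Proof.
  intros Hw Hz Hu Hv; apply norm_le_eps; intros e He.
  assert (Ha : 0 < a + e / 2) by (destruct Hu; lra).
  assert (Hb : 0 < b + e / 2) by (destruct Hv; lra).
  apply (norm_le_mono _ _ _ (a + e / 2)) in Hu; [|lra].
  apply (norm_le_mono _ _ _ (b + e / 2)) in Hv; [|lra].
  replace (a + b + e) with ((a + e / 2) + (b + e / 2)) by lra.
  revert Ha Hb Hu Hv; generalize (a + e / 2) (b + e / 2); clear a b e He.
  intros a b Ha Hb [_ Hu] [_ Hv]; split; [lra|]; intros N.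
  apply Rle_trans with ((a + b) * (/ a * box (fun k => w k * Cmod (u k) ^ 2) N
                                   + / b * box (fun k => w k * Cmod (v k) ^ 2) N)).
  - rewrite <- !box_scal, <- box_plus, <- box_scal; apply box_le; intros k.
    apply Rle_trans with (w k * (Cmod (u k) + Cmod (v k)) ^ 2).
    + apply Rmult_le_compat_l; [apply Hw|].
      apply pow_incr; split; [apply Cmod_ge_0|apply Hz].
    + generalize (Cmod (u k)) (Cmod (v k)); intros x y.
      replace ((a + b) * (/ a * (w k * x ^ 2) + / b * (w k * y ^ 2)))
        with (w k * ((x + y) ^ 2 + / a * / b * (b * x - a * y) ^ 2)) by (field; lra).
      apply Rmult_le_compat_l; [apply Hw|].
      assert (0 <= / a * / b * (b * x - a * y) ^ 2); [|lra].
      apply Rmult_le_pos; [|apply pow2_ge_0].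
      apply Rmult_le_pos; left; apply Rinv_0_lt_compat; assumption.
  - replace ((a + b) ^ 2) with ((a + b) * (/ a * a ^ 2 + / b * b ^ 2)) by (field; lra).
    apply Rmult_le_compat_l; [lra|].
    apply Rplus_le_compat; apply Rmult_le_compat_l; auto;
      left; apply Rinv_0_lt_compat; assumption.
Qed.

Lemma Cmod_minus_le (x y : C) : Cmod (Cminus x y) <= Cmod x + Cmod y.
Proof. unfold Cminus; rewrite <- (Cmod_opp y); apply Cmod_triangle. Qed.

Lemma norm_le_sub (w : Z -> R) (u v : fser) (a b : R) :
  (forall k, 0 <= w k) -> norm_le w u a -> norm_le w v b -> norm_le w (fsub u v) (a + b).
Proof. intros Hw; apply norm_le_bound_plus; [exact Hw|intros k; apply Cmod_minus_le]. Qed.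

Lemma norm_le_add (w : Z -> R) (u v : fser) (a b : R) :
  (forall k, 0 <= w k) -> norm_le w u a -> norm_le w v b -> norm_le w (fadd u v) (a + b).
Proof. intros Hw; apply norm_le_bound_plus; [exact Hw|intros k; apply Cmod_triangle]. Qed.

Lemma norm_le_scal (w : Z -> R) (c : C) (u : fser) (b : R) :
  (forall k, 0 <= w k) -> norm_le w u b -> norm_le w (fscal c u) (Cmod c * b).
Proof.
  intros Hw; apply norm_le_coef_le; [apply Cmod_ge_0|exact Hw|].
  intros k; unfold fscal; rewrite Cmod_mult; apply Rle_refl.
Qed.

Lemma norm_le_zero (w : Z -> R) (b : R) : 0 <= b -> norm_le w fzero b.
Proof.
  intros Hb; split; [exact Hb|]; intros N.
  rewrite (box_ext _ (fun _ => 0 * 0)), box_scal; [|intros k; unfold fzero; rewrite Cmod_0; ring].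
  pose proof (pow2_ge_0 b); lra.
Qed.

Lemma norm_le_sub_sym (w : Z -> R) (u v : fser) (b : R) : norm_le w (fsub u v) b -> norm_le w (fsub v u) b.
Proof.
  intros [Hb H]; split; [exact Hb|]; intros N; erewrite box_ext; [apply H|].
  intros k; simpl; unfold fsub.
  replace (Cminus (v k) (u k)) with (Copp (Cminus (u k) (v k))) by ring.
  now rewrite Cmod_opp.
Qed.

Lemma le_box (g : Z -> R) (k : Z) : (forall j, 0 <= g j) -> exists N, g k <= box g N.
Proof.
  intros H; destruct (isum_le_box g k 1 H) as [N HN]; exists N.
  simpl in HN; rewrite Z.add_0_r in HN; lra.
Qed.

Lemma norm_le_coord (w : Z -> R) (u : fser) (b : R) (k : Z) :
  (forall k, 0 <= w k) -> norm_le w u b -> sqrt (w k) * Cmod (u k) <= b.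
Proof.
  intros Hw [Hb Hu].
  destruct (le_box (fun k => w k * Cmod (u k) ^ 2) k) as [N HN].
  { intros j; apply Rmult_le_pos; [apply Hw|apply pow2_ge_0]. }
  assert (H : (sqrt (w k) * Cmod (u k)) ^ 2 <= b ^ 2).
  { rewrite Rpow_mult_distr, pow2_sqrt by apply Hw.
    eapply Rle_trans; [exact HN|apply Hu]. }
  rewrite <- !Rsqr_pow2 in H; apply Rsqr_incr_0; auto.
  apply Rmult_le_pos; [apply sqrt_pos|apply Cmod_ge_0].
Qed.

Lemma norm_le_0_eq (w : Z -> R) (u : fser) : (forall k, 0 < w k) -> norm_le w u 0 -> u = fzero.
Proof.
  intros Hw H; apply functional_extensionality; intros k.
  pose proof (norm_le_coord w u 0 k (fun k => Rlt_le _ _ (Hw k)) H) as Hk.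
  apply Cmod_eq_0.
  pose proof (sqrt_lt_R0 _ (Hw k)); pose proof (Cmod_ge_0 (u k)); nra.
Qed.

Lemma norm_le_sub_0_eq (w : Z -> R) (u v : fser) :
  (forall k, 0 < w k) -> norm_le w (fsub u v) 0 -> u = v.
Proof.
  intros Hw H; apply functional_extensionality; intros k.
  pose proof (f_equal (fun g => g k) (norm_le_0_eq w _ Hw H)) as E.
  unfold fsub, fzero in E.
  replace (u k) with (Cplus (Cminus (u k) (v k)) (v k)) by ring.
  rewrite E; ring.
Qed.

(** * Least bounds, coordinatewise limits and completeness *)

Definition nrm (w : Z -> R) (u : fser) : R :=
  sqrt (Series (zterm (fun k => w k * Cmod (u k) ^ 2))).

Lemma sq_nonneg (w : Z -> R) (u : fser) :
  (forall k, 0 <= w k) -> forall k, 0 <= w k * Cmod (u k) ^ 2.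
Proof. intros Hw k; apply Rmult_le_pos; [apply Hw|apply pow2_ge_0]. Qed.

Lemma ex_series_norm_le (w : Z -> R) (u : fser) :
  (forall k, 0 <= w k) ->
  ex_series (zterm (fun k => w k * Cmod (u k) ^ 2)) -> norm_le w u (nrm w u).
Proof.
  intros Hw H; split; [apply sqrt_pos|]; intros N.
  pose proof (box_le_Series _ N (sq_nonneg w u Hw) H).
  unfold nrm; rewrite pow2_sqrt; [assumption|].
  eapply Rle_trans; [|exact H0]; apply box_nonneg, sq_nonneg, Hw.
Qed.

Lemma norm_le_ex_series (w : Z -> R) (u : fser) (b : R) :
  (forall k, 0 <= w k) -> norm_le w u b ->
  ex_series (zterm (fun k => w k * Cmod (u k) ^ 2)).
Proof. intros Hw [Hb H]; apply ex_series_box with (b ^ 2); [apply sq_nonneg, Hw|exact H]. Qed.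

Lemma nrm_le_of_norm_le (w : Z -> R) (u : fser) (b : R) :
  (forall k, 0 <= w k) -> norm_le w u b -> nrm w u <= b.
Proof.
  intros Hw H; unfold nrm; rewrite <- (sqrt_pow2 b) by apply H.
  apply sqrt_le_1_alt, Series_le_box; [eapply norm_le_ex_series; eassumption|apply H].
Qed.

Lemma norm_le_nrm (w : Z -> R) (u : fser) (b : R) :
  (forall k, 0 <= w k) -> norm_le w u b -> norm_le w u (nrm w u).
Proof. intros Hw H; apply ex_series_norm_le; [|eapply norm_le_ex_series]; eassumption. Qed.

Lemma is_lim_seq_Cmod (z : nat -> C) (l : C) :
  is_lim_seq (fun n => Re (z n)) (Re l) -> is_lim_seq (fun n => Im (z n)) (Im l) ->
  is_lim_seq (fun n => Cmod (z n) ^ 2) (Cmod l ^ 2).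
Proof.
  assert (E : forall c : C, Cmod c ^ 2 = Re c * Re c + Im c * Im c).
  { intros c; unfold Cmod; rewrite pow2_sqrt; [unfold Re, Im; ring|].
    apply Rplus_le_le_0_compat; apply pow2_ge_0. }
  intros Hr Hi; rewrite E.
  apply is_lim_seq_ext with (fun n => Re (z n) * Re (z n) + Im (z n) * Im (z n)).
  { intros n; symmetry; apply E. }
  apply is_lim_seq_plus'; apply is_lim_seq_mult'; assumption.
Qed.

(** A Fatou property: each box involves finitely many coordinates, so its bound passes to the
    coordinatewise limit. *)
Lemma norm_le_lim (w : Z -> R) (s : nat -> fser) (u : fser) (b : R) :
  (forall k, is_lim_seq (fun n => Re (s n k)) (Re (u k))) ->
  (forall k, is_lim_seq (fun n => Im (s n k)) (Im (u k))) ->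
  (forall n, norm_le w (s n) b) -> norm_le w u b.
Proof.
  intros Hr Hi H; split; [apply (H O)|]; intros N.
  apply (is_lim_seq_le (fun n => box (fun k => w k * Cmod (s n k) ^ 2) N) (fun _ => b ^ 2)
    (Finite (box (fun k => w k * Cmod (u k) ^ 2) N)) (Finite (b ^ 2))).
  - intros n; apply H.
  - apply box_lim; intros k.
    apply is_lim_seq_mult'; [apply is_lim_seq_const|].
    apply is_lim_seq_Cmod; [apply Hr|apply Hi].
  - apply is_lim_seq_const.
Qed.

Lemma im_le_Cmod (z : C) : Rabs (Im z) <= Cmod z.
Proof. eapply Rle_trans; [apply Rmax_r|apply (Rmax_Cmod z)]. Qed.

Lemma re_le_Cmod (z : C) : Rabs (Re z) <= Cmod z.
Proof. eapply Rle_trans; [apply Rmax_l|apply (Rmax_Cmod z)]. Qed.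

Lemma ex_lim_seq_geom (x : nat -> R) (c : R) :
  (forall n, Rabs (x (S n) - x n) <= c * (/ 2) ^ n) -> is_lim_seq x (real (Lim_seq x)).
Proof.
  intros H.
  assert (Hs : ex_series (fun n => x (S n) - x n)).
  { apply (ex_series_le (fun n => x (S n) - x n) (fun n => c * (/ 2) ^ n)); [exact H|].
    apply (ex_series_scal_l c (fun n => (/ 2) ^ n)).
    apply ex_series_geom; rewrite Rabs_pos_eq; lra. }
  apply Lim_seq_correct'; destruct Hs as [l Hl]; exists (x O + l).
  apply is_lim_seq_incr_1.
  apply is_lim_seq_ext with (fun n => x O + sum_n (fun n => x (S n) - x n) n).
  - intros n; induction n as [|n IH]; [rewrite sum_O; ring|].
    rewrite sum_Sn; unfold plus; simpl; simpl in IH; lra.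
  - apply is_lim_seq_plus'; [apply is_lim_seq_const|exact Hl].
Qed.

(** Completeness for geometrically Cauchy sequences, which is all that a contraction of ratio 1/2
    requires. A coordinate is controlled by the norm divided by [sqrt (w k)], so coordinates
    converge; the tail bound then passes to the limit. *)
Lemma norm_le_complete (w : Z -> R) (s : nat -> fser) (b : R) :
  (forall k, 0 < w k) ->
  (forall n, norm_le w (fsub (s (S n)) (s n)) (b * (/ 2) ^ n)) ->
  exists u, forall n, norm_le w (fsub u (s n)) (2 * b * (/ 2) ^ n).
Proof.
  intros Hw H.
  assert (Hw0 : forall k, 0 <= w k) by (intros k; left; apply Hw).
  assert (Hb : 0 <= b) by (destruct (H O) as [h _]; simpl in h; lra).
  assert (Hp : forall n, 0 <= (/ 2) ^ n) by (intros n; apply pow_le; lra).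
  assert (Hk : forall k n, Cmod (Cminus (s (S n) k) (s n k)) <= b / sqrt (w k) * (/ 2) ^ n).
  { intros k n; pose proof (norm_le_coord w _ _ k Hw0 (H n)) as h.
    pose proof (sqrt_lt_R0 _ (Hw k)).
    apply Rmult_le_reg_l with (sqrt (w k)); [assumption|].
    replace (sqrt (w k) * (b / sqrt (w k) * (/ 2) ^ n)) with (b * (/ 2) ^ n); [exact h|].
    field; lra. }
  assert (Hq : forall n q, norm_le w (fsub (s (n + q)%nat) (s n)) (2 * b * (/ 2) ^ n)).
  { intros n q.
    (* The induction on [q] needs the exact geometric sum of [b / 2^(n+j)] over [j < q]; the bound
       without the factor [1 - 2^(-q)] would not reproduce itself. *)
    apply norm_le_mono with (2 * b * (/ 2) ^ n * (1 - (/ 2) ^ q)).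
    { pose proof (Hp q); pose proof (Rmult_le_pos _ _ (Rmult_le_pos _ _ (Rlt_le _ _ Rlt_0_2) Hb) (Hp n)); nra. }
    induction q as [|q IH].
    - rewrite Nat.add_0_r.
      replace (fsub (s n) (s n)) with fzero.
      { apply norm_le_zero; simpl; lra. }
      apply functional_extensionality; intros k; unfold fsub, fzero; ring.
    - replace (2 * b * (/ 2) ^ n * (1 - (/ 2) ^ S q))
        with (2 * b * (/ 2) ^ n * (1 - (/ 2) ^ q) + b * (/ 2) ^ (n + q)).
      2:{ rewrite pow_add; simpl; field. }
      rewrite Nat.add_succ_r.
      refine (norm_le_bound_plus w _ _ _ _ _ Hw0 _ IH (H (n + q)%nat)).
      intros k; unfold fsub.
      replace (Cminus (s (S (n + q)) k) (s n k))
        with (Cplus (Cminus (s (n + q)%nat k) (s n k)) (Cminus (s (S (n + q)) k) (s (n + q)%nat k))) by ring.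
      apply Cmod_triangle. }
  exists (fun k => (real (Lim_seq (fun n => Re (s n k))), real (Lim_seq (fun n => Im (s n k))))).
  intros n; apply norm_le_lim with (fun q => fsub (s (n + q)%nat) (s n)).
  - intros k; unfold fsub; simpl.
    apply is_lim_seq_plus'; [|apply is_lim_seq_const].
    apply is_lim_seq_ext with (fun q => Re (s (q + n)%nat k)).
    { intros q; now rewrite Nat.add_comm. }
    apply (is_lim_seq_incr_n (fun q => Re (s q k)) n).
    apply ex_lim_seq_geom with (b / sqrt (w k)); intros p.
    eapply Rle_trans; [apply (re_le_Cmod (Cminus (s (S p) k) (s p k)))|apply Hk].
  - intros k; unfold fsub; simpl.
    apply is_lim_seq_plus'; [|apply is_lim_seq_const].
    apply is_lim_seq_ext with (fun q => Im (s (q + n)%nat k)).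
    { intros q; now rewrite Nat.add_comm. }
    apply (is_lim_seq_incr_n (fun q => Im (s q k)) n).
    apply ex_lim_seq_geom with (b / sqrt (w k)); intros p.
    eapply Rle_trans; [apply (im_le_Cmod (Cminus (s (S p) k) (s p k)))|apply Hk].
  - intros q; apply Hq.
Qed.
(** * Perturbation of invertible operators *)

Definition dual (w : Z -> R) : Z -> R := fun k => / w k.

(** Restricted to arguments of finite norm, since the series defining [mult_op] can be split only
    when both converge. *)
Definition fadditive (w : Z -> R) (T : fser -> fser) : Prop :=
  forall x x' a a', norm_le w x a -> norm_le w x' a' -> T (fsub x x') = fsub (T x) (T x').

Definition fbounded (w : Z -> R) (T : fser -> fser) (d : R) : Prop :=
  forall x b, norm_le w x b -> norm_le (dual w) (T x) (d * b).

(** Surjectivity onto [Y] is qualitative; all quantitative content is the a priori estimate, in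
    which [a] merely records that [x] lies in [X]. For additive [T] the estimate also gives
    injectivity, so [M] bounds the inverse. *)
Definition invertible (w : Z -> R) (T : fser -> fser) (M : R) : Prop :=
  (forall y b, norm_le (dual w) y b -> exists x a, norm_le w x a /\ T x = y) /\
  (forall x a b, norm_le w x a -> norm_le (dual w) (T x) b -> norm_le w x (M * b)).

Lemma dual_pos (w : Z -> R) : (forall k, 0 < w k) -> forall k, 0 < dual w k.
Proof. intros Hw k; apply Rinv_0_lt_compat, Hw. Qed.

Lemma geom_half_small (c e : R) : 0 < e -> exists n, c * (/ 2) ^ n <= e.
Proof.
  intros He.
  assert (Hc : 0 < Rabs c + 1) by (pose proof (Rabs_pos c); lra).
  destruct (pow_lt_1_zero (/ 2)) with (y := e / (Rabs c + 1)) as [n Hn].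
  - rewrite Rabs_pos_eq; lra.
  - apply Rdiv_lt_0_compat; assumption.
  - exists n; specialize (Hn n (Nat.le_refl n)).
    pose proof (pow_le (/ 2) n ltac:(lra)) as Hp.
    rewrite Rabs_pos_eq in Hn by exact Hp.
    apply Rle_trans with ((Rabs c + 1) * (/ 2) ^ n).
    + apply Rmult_le_compat_r; [exact Hp|]; pose proof (Rle_abs c); lra.
    + apply Rle_trans with ((Rabs c + 1) * (e / (Rabs c + 1))).
      * apply Rmult_le_compat_l; lra.
      * right; field; lra.
Qed.

Lemma norm_le_geom_0 (w : Z -> R) (u : fser) (c : R) :
  (forall n, norm_le w u (c * (/ 2) ^ n)) -> norm_le w u 0.
Proof.
  intros H; apply norm_le_eps; intros e He.
  destruct (geom_half_small c e He) as [n Hn].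
  apply norm_le_mono with (c * (/ 2) ^ n); [lra|apply H].
Qed.

Ltac fser_ring :=
  apply functional_extensionality; intros ?k; unfold fsub, fadd, fscal, fzero; ring.

Lemma fsub_fzero (u : fser) : fsub u fzero = u.
Proof. fser_ring. Qed.

(** The Neumann series is run as the fixed point iteration [x -> T^(-1) (y - B x)], a contraction of
    ratio [M * d <= 1/2]; the factor 2 is [1 / (1 - 1/2)]. *)
Lemma neumann (w : Z -> R) (T B : fser -> fser) (M d : R) :
  (forall k, 0 < w k) -> 0 <= M -> M * d <= / 2 ->
  fadditive w T -> fadditive w B -> fbounded w B d -> invertible w T M ->
  invertible w (fun x => fadd (T x) (B x)) (2 * M).
Proof.
  intros Hw HM Hd HT HB HBd [Hsurj Hbd].
  assert (Hw0 : forall k, 0 <= w k) by (intros k; left; apply Hw).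
  assert (Hdw0 : forall k, 0 <= dual w k) by (intros k; left; apply dual_pos, Hw).
  assert (Hhalf : forall b, 0 <= b -> M * (d * b) <= / 2 * b).
  { intros b Hb; rewrite <- Rmult_assoc; apply Rmult_le_compat_r; assumption. }
  split.
  - intros y b Hy.
    pose (G := fun z => epsilon (inhabits fzero) (fun x => (exists a, norm_le w x a) /\ T x = z)).
    assert (HG : forall z c, norm_le (dual w) z c -> (exists a, norm_le w (G z) a) /\ T (G z) = z).
    { intros z c Hz; apply (epsilon_spec (inhabits fzero) (fun x => (exists a, norm_le w x a) /\ T x = z)).
      destruct (Hsurj z c Hz) as [x [a [Hx HTx]]]; exists x; split; [exists a|]; assumption. }
    pose (F := fun x => G (fsub y (B x))).
    assert (HF : forall x a, norm_le w x a -> (exists a', norm_le w (F x) a') /\ T (F x) = fsub y (B x)).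
    { intros x a Hx; apply (HG _ (b + d * a)); apply norm_le_sub; [exact Hdw0|exact Hy|apply HBd, Hx]. }
    assert (HFF : forall x x' a a' c, norm_le w x a -> norm_le w x' a' -> norm_le w (fsub x x') c ->
                  norm_le w (fsub (F x) (F x')) (/ 2 * c)).
    { intros x x' a a' c Hx Hx' Hc.
      destruct (HF x a Hx) as [[p Hp] Ep]; destruct (HF x' a' Hx') as [[p' Hp'] Ep'].
      apply norm_le_mono with (M * (d * c)); [apply Hhalf, Hc|].
      apply (Hbd _ (p + p')); [apply norm_le_sub; assumption|].
      rewrite (HT _ _ p p' Hp Hp'), Ep, Ep'.
      replace (fsub (fsub y (B x)) (fsub y (B x'))) with (fsub (B x') (B x)) by fser_ring.
      apply norm_le_sub_sym; rewrite <- (HB _ _ a a' Hx Hx').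
      apply HBd, Hc. }
    pose (s := fun n => Nat.iter n F fzero).
    assert (Hs : forall n, exists a, norm_le w (s n) a).
    { induction n as [|n [a IH]].
      - exists 0; apply norm_le_zero; lra.
      - apply (HF (s n) a IH). }
    destruct (Hs 1%nat) as [c Hc].
    assert (Hdiff : forall n, norm_le w (fsub (s (S n)) (s n)) (c * (/ 2) ^ n)).
    { induction n as [|n IH].
      - replace (fsub (s 1%nat) (s 0%nat)) with (s 1%nat) by (simpl; symmetry; apply fsub_fzero).
        simpl; rewrite Rmult_1_r; exact Hc.
      - destruct (Hs (S n)) as [p Hp]; destruct (Hs n) as [p' Hp'].
        replace (c * (/ 2) ^ S n) with (/ 2 * (c * (/ 2) ^ n)) by (simpl; ring).
        exact (HFF _ _ p p' _ Hp Hp' IH). }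
    destruct (norm_le_complete w s c Hw Hdiff) as [u Hu].
    assert (HuX : norm_le w u (2 * c * (/ 2) ^ 0)) by (rewrite <- (fsub_fzero u); apply (Hu O)).
    assert (EF : F u = u).
    { apply (norm_le_sub_0_eq w); [exact Hw|].
      apply norm_le_geom_0 with (2 * c); intros n.
      destruct (Hs n) as [p Hp].
      (* Both [F u] and [u] are compared with [s (S n)], which is [F (s n)]: the contraction handles
         the first distance and the tail bound the second. *)
      replace (2 * c * (/ 2) ^ n) with (/ 2 * (2 * c * (/ 2) ^ n) + 2 * c * (/ 2) ^ (S n))
        by (simpl; field).
      replace (fsub (F u) u) with (fsub (fsub (F u) (s (S n))) (fsub u (s (S n)))) by fser_ring.
      apply norm_le_sub; [exact Hw0| |apply Hu].
      exact (HFF _ _ _ p _ HuX Hp (Hu n)). }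
    exists u, (2 * c * (/ 2) ^ 0); split; [exact HuX|].
    destruct (HF u _ HuX) as [_ E]; rewrite EF in E; rewrite E; fser_ring.
  - intros x a b Hx Hb.
    (* Taking the least bound of [x] allows absorption: [|x| <= M b + |x| / 2], where [|x|] is
       finite because [x] lies in [X]. *)
    pose proof (norm_le_nrm w x a Hw0 Hx) as Hn.
    assert (H : norm_le w x (M * (b + d * nrm w x))).
    { apply (Hbd x a); [exact Hx|].
      replace (T x) with (fsub (fadd (T x) (B x)) (B x)) by fser_ring.
      apply norm_le_sub; [exact Hdw0|exact Hb|apply HBd, Hn]. }
    pose proof (nrm_le_of_norm_le w x _ Hw0 H) as H1.
    pose proof (Hhalf (nrm w x) (proj1 Hn)).
    apply norm_le_mono with (nrm w x); [|exact Hn]; lra.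
Qed.

(** * Multiplication as a Hilbert-Schmidt operator *)

Lemma box_Cauchy_Schwarz (x p h : Z -> R) (N : nat) :
  (forall k, 0 <= p k) -> (forall k, 0 <= h k) -> (forall k, x k ^ 2 <= p k * h k) ->
  box x N ^ 2 <= box p N * box h N.
Proof.
  intros Hp Hh Hx.
  assert (step : forall X P H a b c, 0 <= P -> 0 <= H -> 0 <= b -> 0 <= c ->
            X ^ 2 <= P * H -> a ^ 2 <= b * c -> (X + a) ^ 2 <= (P + b) * (H + c)).
  { intros X P H a b c HP HH Hb Hc HX Ha.
    (* The cross term is handled after squaring: [4 X^2 a^2 <= 4 (P c) (b H) <= (P c + b H)^2]. *)
    assert (2 * (X * a) <= P * c + b * H); [|nra].
    apply Rsqr_incr_0_var; [|nra].
    unfold Rsqr.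
    assert (X ^ 2 * a ^ 2 <= (P * H) * (b * c)).
    { apply Rmult_le_compat; auto; apply pow2_ge_0. }
    pose proof (pow2_ge_0 (P * c - b * H)); nra. }
  induction N as [|N IH]; simpl box; [lra|].
  unfold zterm; rewrite <- !Rplus_assoc.
  pose proof (box_nonneg p N Hp); pose proof (box_nonneg h N Hh).
  pose proof (Hp (Z.of_nat N)); pose proof (Hh (Z.of_nat N)).
  apply step; auto using Rplus_le_le_0_compat.
Qed.

Lemma ex_series_Re (a : Z -> C) :
  ex_series (zterm (fun k => Cmod (a k))) -> ex_series (zterm (fun k => Re (a k))).
Proof. apply ex_series_zterm_le; intros k; apply re_le_Cmod. Qed.

Lemma ex_series_Im (a : Z -> C) :
  ex_series (zterm (fun k => Cmod (a k))) -> ex_series (zterm (fun k => Im (a k))).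
Proof. apply ex_series_zterm_le; intros k; apply im_le_Cmod. Qed.

(** The triangle inequality is applied to complex partial sums before the limit; bounding real and
    imaginary parts separately would lose a constant. *)
Lemma zsumC_bound (a : Z -> C) (B : R) :
  0 <= B -> ex_series (zterm (fun k => Cmod (a k))) ->
  (forall N, box (fun k => Cmod (a k)) N <= B) -> Cmod (zsumC a) <= B.
Proof.
  intros HB Hex H.
  assert (Hr : ex_series (zterm (fun k => Re (a k)))) by (apply ex_series_Re, Hex).
  assert (Hi : ex_series (zterm (fun k => Im (a k)))) by (apply ex_series_Im, Hex).
  pose (z := fun N => (box (fun k => Re (a k)) N, box (fun k => Im (a k)) N) : C).
  assert (Hz : forall N, Cmod (z N) <= box (fun k => Cmod (a k)) N).
  { induction N as [|N IH].
    - change (z O) with (RtoC 0); rewrite Cmod_0; simpl; lra.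
    - replace (z (S N)) with (Cplus (z N) (Cplus (a (Z.of_nat N)) (a (- Z.of_nat N - 1)%Z))) by reflexivity.
      eapply Rle_trans; [apply Cmod_triangle|]; apply Rplus_le_compat; [exact IH|].
      apply Cmod_triangle. }
  assert (Hsq : Cmod (zsumC a) ^ 2 <= B ^ 2).
  { apply (is_lim_seq_le (fun N => Cmod (z N) ^ 2) (fun _ => B ^ 2)
      (Finite (Cmod (zsumC a) ^ 2)) (Finite (B ^ 2))).
    - intros N; apply pow_incr; split; [apply Cmod_ge_0|].
      eapply Rle_trans; [apply Hz|apply H].
    - apply is_lim_seq_Cmod; [exact (Series_box _ Hr)|exact (Series_box _ Hi)].
    - apply is_lim_seq_const. }
  rewrite <- !Rsqr_pow2 in Hsq; apply Rsqr_incr_0_var; assumption.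
Qed.

Lemma Series_zterm_minus (f g : Z -> R) :
  ex_series (zterm f) -> ex_series (zterm g) ->
  Series (zterm (fun k => f k - g k)) = Series (zterm f) - Series (zterm g).
Proof.
  intros Hf Hg; rewrite <- Series_minus by assumption.
  apply Series_ext; intros n; unfold zterm; ring.
Qed.

Lemma zsumC_minus (a b : Z -> C) :
  ex_series (zterm (fun k => Cmod (a k))) -> ex_series (zterm (fun k => Cmod (b k))) ->
  zsumC (fun k => Cminus (a k) (b k)) = Cminus (zsumC a) (zsumC b).
Proof.
  intros Ha Hb; unfold zsumC.
  change (fun k => Re (Cminus (a k) (b k))) with (fun k => Re (a k) - Re (b k)).
  change (fun k => Im (Cminus (a k) (b k))) with (fun k => Im (a k) - Im (b k)).
  rewrite !Series_zterm_minus by (apply ex_series_Re || apply ex_series_Im; assumption).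
  reflexivity.
Qed.

(* [dominated w v C] compares the weight [w] of the domain with the weight [v]
   of the potential: it makes W(k-i) / sqrt (w k * w i) square summable in (k, i). *)
Definition dominated (w v : Z -> R) (C : R) : Prop :=
  0 <= C /\ (forall k, 1 <= w k) /\ (forall j, 0 <= v j) /\
  (forall k i, 1 <= C * (w k + w i) * v (k - i)%Z).

Lemma dominated_coef (w v : Z -> R) (C : R) (W : fser) (k i : Z) :
  dominated w v C ->
  Cmod (W (k - i)%Z) ^ 2 <= C * (w k + w i) * (v (k - i)%Z * Cmod (W (k - i)%Z) ^ 2).
Proof.
  intros [_ [_ [_ H]]]; pose proof (pow2_ge_0 (Cmod (W (k - i)%Z))); specialize (H k i); nra.
Qed.

(** Since [w >= 1], the quotient [(w k + w i) / w i] is at most [w k + 1]. The bound grows with [k],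
    so it serves only for convergence of each row. *)
Lemma dominated_row (w v : Z -> R) (C A : R) (W : fser) (k : Z) :
  dominated w v C -> norm_le v W A ->
  ex_series (zterm (fun i => Cmod (W (k - i)%Z) ^ 2 * / w i)).
Proof.
  intros Hd [HA HW]; pose proof Hd as [HC [Hw [Hv _]]].
  assert (Hw0 : forall k, 0 < w k) by (intros j; specialize (Hw j); lra).
  apply ex_series_box with (C * (w k + 1) * A ^ 2).
  - intros i; apply Rmult_le_pos; [apply pow2_ge_0|left; apply Rinv_0_lt_compat, Hw0].
  - intros N.
    pose (g := fun j => v j * Cmod (W j) ^ 2).
    apply Rle_trans with (C * (w k + 1) * box (fun i => g (k - i)%Z) N).
    + rewrite <- box_scal; apply box_le; intros i.
      pose proof (dominated_coef w v C W k i Hd) as H; fold (g (k - i)%Z) in H.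
      assert (0 <= g (k - i)%Z) by (apply sq_nonneg, Hv).
      apply Rmult_le_reg_r with (w i); [apply Hw0|].
      rewrite Rmult_assoc, Rinv_l, Rmult_1_r by (specialize (Hw0 i); lra).
      eapply Rle_trans; [exact H|].
      pose proof (Hw i); pose proof (Hw k).
      replace (C * (w k + 1) * g (k - i)%Z * w i) with (C * ((w k + 1) * w i) * g (k - i)%Z) by ring.
      apply Rmult_le_compat_r; [assumption|]; apply Rmult_le_compat_l; [assumption|nra].
    + apply Rmult_le_compat_l.
      * apply Rmult_le_pos; [assumption|specialize (Hw k); lra].
      * apply box_reflect_le; [apply sq_nonneg, Hv|exact HW].
Qed.

(** Termwise, [|W u| <= |W|^2 / w + w |u|^2]; the first part is a row sum and the second is the norm
    of [u]. *)
Lemma mult_op_summable (w v : Z -> R) (C A b : R) (W u : fser) (k : Z) :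
  dominated w v C -> norm_le v W A -> norm_le w u b ->
  ex_series (zterm (fun i => Cmod (Cmult (W (k - i)%Z) (u i)))).
Proof.
  intros Hd HW Hu; pose proof Hd as [_ [Hw _]].
  assert (Hw0 : forall k, 0 <= w k) by (intros j; specialize (Hw j); lra).
  apply ex_series_zterm_le with
    (fun i => Cmod (W (k - i)%Z) ^ 2 * / w i + w i * Cmod (u i) ^ 2).
  - intros i; rewrite Cmod_mult, Rabs_pos_eq by (apply Rmult_le_pos; apply Cmod_ge_0).
    generalize (Cmod (W (k - i)%Z)) (Cmod (u i)); intros x y; specialize (Hw i).
    assert (E : x ^ 2 * / w i + w i * y ^ 2 = / w i * ((x ^ 2 + (w i * y) ^ 2))) by (field; lra).
    rewrite E; apply Rmult_le_reg_l with (w i); [lra|].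
    rewrite <- (Rmult_assoc (w i) (/ w i)), Rinv_r, Rmult_1_l by lra.
    pose proof (pow2_ge_0 (x - w i * y)); pose proof (pow2_ge_0 (x + w i * y)); nra.
  - apply ex_series_ext with (fun n => zterm (fun i => Cmod (W (k - i)%Z) ^ 2 * / w i) n
                                       + zterm (fun i => w i * Cmod (u i) ^ 2) n).
    { intros n; match goal with |- ?a = ?b => change (@eq R a b) end; unfold zterm; ring. }
    apply (ex_series_plus (zterm (fun i => Cmod (W (k - i)%Z) ^ 2 * / w i))
                          (zterm (fun i => w i * Cmod (u i) ^ 2))).
    + eapply dominated_row; eassumption.
    + eapply norm_le_ex_series; eassumption.
Qed.

Lemma mult_op_sub_r (w v : Z -> R) (C A a b : R) (W u u' : fser) :
  dominated w v C -> norm_le v W A -> norm_le w u a -> norm_le w u' b ->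
  mult_op W (fsub u u') = fsub (mult_op W u) (mult_op W u').
Proof.
  intros Hd HW Hu Hu'; apply functional_extensionality; intros k; unfold mult_op.
  unfold fsub at 2; rewrite <- zsumC_minus by (eapply mult_op_summable; eassumption).
  f_equal; apply functional_extensionality; intros i; unfold fsub; ring.
Qed.

Lemma mult_op_sub_l (w v : Z -> R) (C A A' b : R) (W W' u : fser) :
  dominated w v C -> norm_le v W A -> norm_le v W' A' -> norm_le w u b ->
  mult_op (fsub W W') u = fsub (mult_op W u) (mult_op W' u).
Proof.
  intros Hd HW HW' Hu; apply functional_extensionality; intros k; unfold mult_op.
  unfold fsub at 2; rewrite <- zsumC_minus by (eapply mult_op_summable; eassumption).
  f_equal; apply functional_extensionality; intros i; unfold fsub; ring.
Qed.

Lemma mult_op_row_bound (w v : Z -> R) (C A b : R) (W u : fser) (k : Z) :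
  dominated w v C -> norm_le v W A -> norm_le w u b ->
  Cmod (mult_op W u k) ^ 2 <= Series (zterm (fun i => Cmod (W (k - i)%Z) ^ 2 * / w i)) * b ^ 2.
Proof.
  intros Hd HW Hu; pose proof Hd as [_ [Hw _]].
  pose proof (dominated_row w v C A W k Hd HW) as Hrow.
  set (r := Series (zterm (fun i => Cmod (W (k - i)%Z) ^ 2 * / w i))) in *.
  assert (Hq : forall i, 0 <= Cmod (W (k - i)%Z) ^ 2 * / w i).
  { intros i; apply Rmult_le_pos; [apply pow2_ge_0|].
    left; apply Rinv_0_lt_compat; specialize (Hw i); lra. }
  assert (Hr : 0 <= r) by exact (box_le_Series _ O Hq Hrow).
  assert (Hb : 0 <= b) by apply Hu.
  assert (H : Cmod (mult_op W u k) <= sqrt r * b).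
  { apply zsumC_bound; [apply Rmult_le_pos; [apply sqrt_pos|exact Hb]| |].
    - eapply mult_op_summable; eassumption.
    - intros N; apply Rsqr_incr_0_var; [|apply Rmult_le_pos; [apply sqrt_pos|exact Hb]].
      rewrite !Rsqr_pow2, Rpow_mult_distr, pow2_sqrt by exact Hr.
      eapply Rle_trans; [apply box_Cauchy_Schwarz with
        (p := fun i => Cmod (W (k - i)%Z) ^ 2 * / w i) (h := fun i => w i * Cmod (u i) ^ 2)|].
      + exact Hq.
      + apply sq_nonneg; intros i; specialize (Hw i); lra.
      + intros i; rewrite Cmod_mult; right; field; specialize (Hw i); lra.
      + apply Rmult_le_compat.
        * apply box_nonneg, Hq.
        * apply box_nonneg, sq_nonneg; intros i; specialize (Hw i); lra.
        * apply box_le_Series; assumption.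
        * apply Hu. }
  rewrite <- (pow2_sqrt r Hr), <- Rpow_mult_distr.
  apply pow_incr; split; [apply Cmod_ge_0|exact H].
Qed.

(** Domination turns [1 / (w k * w i)] into [1 / w i + 1 / w k]. Each half decouples into a sum of
    [1 / w], at most [S], times a translated or reflected copy of the norm of [W], at most [A^2];
    hence the factor 2. *)
Lemma hilbert_schmidt_bound (w v : Z -> R) (C S A : R) (W : fser) (N : nat) :
  dominated w v C -> (forall K, box (dual w) K <= S) -> norm_le v W A ->
  box (fun k => / w k * Series (zterm (fun i => Cmod (W (k - i)%Z) ^ 2 * / w i))) N
    <= 2 * C * S * A ^ 2.
Proof.
  intros Hd HS HW; pose proof Hd as [HC [Hw [Hv _]]].
  assert (Hw0 : forall k, 0 < w k) by (intros j; specialize (Hw j); lra).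
  assert (Hi0 : forall k, 0 <= / w k) by (intros j; left; apply Rinv_0_lt_compat, Hw0).
  pose (g := fun j => v j * Cmod (W j) ^ 2).
  assert (Hg : forall j, 0 <= g j) by (apply sq_nonneg, Hv).
  pose (q := fun k i => Cmod (W (k - i)%Z) ^ 2 * / w i).
  apply (is_lim_seq_le (fun M => box (fun k => / w k * box (q k) M) N) (fun _ => 2 * C * S * A ^ 2)
    (Finite (box (fun k => / w k * Series (zterm (q k))) N)) (Finite (2 * C * S * A ^ 2))).
  (* The inner series is truncated at [M], so the double sum is finite and may be reordered. *)
  - intros M.
    apply Rle_trans with (box (fun k => box (fun i => C * (/ w i * g (k - i)%Z)
                                                     + C * (/ w k * g (k - i)%Z)) M) N).
    + apply box_le; intros k; rewrite <- box_scal; apply box_le; intros i.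
      pose proof (dominated_coef w v C W k i Hd) as H; fold (g (k - i)%Z) in H.
      unfold q.
      replace (C * (/ w i * g (k - i)%Z) + C * (/ w k * g (k - i)%Z))
        with (/ w k * (C * (w k + w i) * g (k - i)%Z * / w i))
        by (field; split; apply Rgt_not_eq, Hw0).
      apply Rmult_le_compat_l; [apply Hi0|].
      apply Rmult_le_compat_r; [apply Hi0|exact H].
    + rewrite (box_ext _ (fun k => C * box (fun i => / w i * g (k - i)%Z) M
                                   + C * box (fun i => / w k * g (k - i)%Z) M)).
      2:{ intros k; rewrite box_plus, !box_scal; reflexivity. }
      (* In the half weighted by [1 / w i] the sum over [k] has to be taken first. *)
      rewrite box_plus, !box_scal, (box_swap (fun k i => / w i * g (k - i)%Z)).
      assert (HA : 0 <= A ^ 2) by apply pow2_ge_0.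
      assert (H1 : box (fun i => box (fun k => / w i * g (k - i)%Z) N) M <= S * A ^ 2).
      { apply Rle_trans with (box (dual w) M * A ^ 2).
        - rewrite Rmult_comm, <- box_scal; apply box_le; intros i.
          rewrite box_scal, Rmult_comm; unfold dual.
          apply Rmult_le_compat_r; [apply Hi0|]; apply box_shift_le; [exact Hg|apply HW].
        - apply Rmult_le_compat_r; auto. }
      assert (H2 : box (fun k => box (fun i => / w k * g (k - i)%Z) M) N <= S * A ^ 2).
      { apply Rle_trans with (box (dual w) N * A ^ 2).
        - rewrite Rmult_comm, <- box_scal; apply box_le; intros k.
          rewrite box_scal, Rmult_comm; unfold dual.
          apply Rmult_le_compat_r; [apply Hi0|]; apply box_reflect_le; [exact Hg|apply HW].
        - apply Rmult_le_compat_r; auto. }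
      apply (Rmult_le_compat_l C) in H1; [|exact HC].
      apply (Rmult_le_compat_l C) in H2; [|exact HC]; lra.
  - apply box_lim; intros k.
    apply is_lim_seq_mult'; [apply is_lim_seq_const|].
    apply Series_box; eapply dominated_row; eassumption.
  - apply is_lim_seq_const.
Qed.

Lemma mult_op_bounded (w v : Z -> R) (C S A : R) (W : fser) :
  dominated w v C -> (forall K, box (dual w) K <= S) -> norm_le v W A ->
  fbounded w (mult_op W) (sqrt (2 * C * S) * A).
Proof.
  intros Hd HS HW u b Hu; pose proof Hd as [HC [Hw [Hv _]]].
  assert (Hw0 : forall k, 0 < w k) by (intros j; specialize (Hw j); lra).
  assert (HS0 : 0 <= S) by exact (HS O).
  split.
  - repeat apply Rmult_le_pos; [apply sqrt_pos|apply HW|apply Hu].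
  - intros N; rewrite !Rpow_mult_distr, pow2_sqrt.
    2:{ repeat apply Rmult_le_pos; lra. }
    apply Rle_trans with
      (b ^ 2 * box (fun k => / w k * Series (zterm (fun i => Cmod (W (k - i)%Z) ^ 2 * / w i))) N).
    + rewrite <- box_scal; apply box_le; intros k.
      rewrite Rmult_comm, (Rmult_comm (/ w k)), <- Rmult_assoc, (Rmult_comm (b ^ 2)).
      apply Rmult_le_compat_r; [left; apply Rinv_0_lt_compat, Hw0|].
      eapply mult_op_row_bound; eassumption.
    + rewrite Rmult_comm; apply Rmult_le_compat_r; [apply pow2_ge_0|].
      eapply hilbert_schmidt_bound; eassumption.
Qed.
(** * The weight of the shifted free operator *)

Definition omega (sg : bool) (m : nat) (mu : R) (k : Z) : R :=
  (IZR (mode sg k) * PI) ^ (2 * m) + mu.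

Lemma PI_ge_1 : 1 <= PI.
Proof. pose proof PI2_1; lra. Qed.

Lemma even_pow_nonneg (x : R) (m : nat) : 0 <= x ^ (2 * m).
Proof. rewrite pow_mult; apply pow_le, pow2_ge_0. Qed.

Lemma omega_ge (sg : bool) (m : nat) (mu : R) (k : Z) : mu <= omega sg m mu k.
Proof. unfold omega; pose proof (even_pow_nonneg (IZR (mode sg k) * PI) m); lra. Qed.

Lemma bracket_ge_1 (n : Z) : 1 <= bracket n.
Proof. unfold bracket; pose proof (Rabs_pos (IZR n)); lra. Qed.

Lemma sq_le_mul_PI (x : R) : x ^ 2 <= (x * PI) ^ 2.
Proof.
  rewrite Rpow_mult_distr; pose proof (pow2_ge_0 x).
  pose proof (pow_R1_Rle PI 2 PI_ge_1); nra.
Qed.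

Lemma IZR_abs_ge_1 (n : Z) : n <> 0%Z -> 1 <= Rabs (IZR n).
Proof. intros H; rewrite <- abs_IZR; apply IZR_le; lia. Qed.

(** For a nonzero mode, [1 + |n| <= 2 |n| <= 2 |n| PI], whence [4^m]; the zero mode is covered by
    [mu >= 1]. *)
Lemma bracket_pow_le_omega (sg : bool) (m : nat) (mu : R) (k : Z) :
  1 <= mu -> bracket (mode sg k) ^ (2 * m) <= 4 ^ m * omega sg m mu k.
Proof.
  intros Hmu; unfold omega; generalize (mode sg k); intros n.
  pose proof (even_pow_nonneg (IZR n * PI) m) as H0.
  assert (H4 : 1 <= 4 ^ m) by (apply pow_R1_Rle; lra).
  destruct (Z.eq_dec n 0) as [->|Hn].
  - unfold bracket; rewrite Rabs_R0, Rplus_0_r, pow1; nra.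
  - apply Rle_trans with (4 ^ m * (IZR n * PI) ^ (2 * m)).
    + rewrite !pow_mult, <- Rpow_mult_distr; apply pow_incr; split; [apply pow2_ge_0|].
      unfold bracket; pose proof (IZR_abs_ge_1 n Hn).
      pose proof (sq_le_mul_PI (IZR n)); pose proof (pow2_abs (IZR n)); nra.
    + apply Rmult_le_compat_l; lra.
Qed.

Lemma pow_plus_le (a b : R) (m : nat) :
  0 <= a -> 0 <= b -> (a + b) ^ (2 * m) <= 4 ^ m * (a ^ (2 * m) + b ^ (2 * m)).
Proof.
  intros Ha Hb.
  pose proof (even_pow_nonneg a m); pose proof (even_pow_nonneg b m).
  assert (H4 : 0 < 4 ^ m) by (apply pow_lt; lra).
  destruct (Rle_dec a b) as [h|h].
  - apply Rle_trans with (4 ^ m * b ^ (2 * m)).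
    + rewrite !pow_mult, <- Rpow_mult_distr; apply pow_incr; split; [apply pow2_ge_0|nra].
    + apply Rmult_le_compat_l; lra.
  - apply Rle_trans with (4 ^ m * a ^ (2 * m)).
    + rewrite !pow_mult, <- Rpow_mult_distr; apply pow_incr; split; [apply pow2_ge_0|nra].
    + apply Rmult_le_compat_l; lra.
Qed.

Lemma weight_pos (sg : bool) (s k : Z) : 0 < weight sg s k.
Proof. apply powerRZ_lt; pose proof (bracket_ge_1 (mode sg k)); lra. Qed.

Lemma weight_nonneg (sg : bool) (s k : Z) : 0 <= weight sg s k.
Proof. left; apply weight_pos. Qed.

Lemma weight_nat (sg : bool) (m : nat) (k : Z) :
  weight sg (Z.of_nat m) k = bracket (mode sg k) ^ (2 * m).
Proof. unfold weight; rewrite pow_powerRZ; f_equal; lia. Qed.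

Lemma weight_opp (sg : bool) (m : nat) (k : Z) :
  weight sg (- Z.of_nat m) k = / bracket (mode sg k) ^ (2 * m).
Proof.
  unfold weight; rewrite pow_powerRZ, <- powerRZ_neg'; f_equal; lia.
Qed.

(** A Peetre-type inequality, [<n_k - n_i> <= <n_k> + <n_i>]. One factor [4^m] splits the power of
    the sum, the other compares brackets with [omega]. In either parity the difference of two modes
    is even, which is why the potential carries [mode true (k - i)]. *)
Lemma omega_dominated (sg : bool) (m : nat) (mu : R) :
  1 <= mu -> dominated (omega sg m mu) (weight true (- Z.of_nat m)) (16 ^ m).
Proof.
  intros Hmu; repeat split.
  - apply pow_le; lra.
  - intros k; pose proof (omega_ge sg m mu k); lra.
  - intros j; apply weight_nonneg.
  - intros k i; rewrite weight_opp.
    set (t := bracket (mode true (k - i)) ^ (2 * m)).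
    assert (Ht : 0 < t) by (apply pow_lt; pose proof (bracket_ge_1 (mode true (k - i))); lra).
    apply Rmult_le_reg_r with t; [exact Ht|].
    rewrite Rmult_assoc, Rinv_l, Rmult_1_r, Rmult_1_l by lra.
    pose proof (bracket_ge_1 (mode sg k)) as Hk; pose proof (bracket_ge_1 (mode sg i)) as Hi.
    apply Rle_trans with ((bracket (mode sg k) + bracket (mode sg i)) ^ (2 * m)).
    + apply pow_incr; split; [pose proof (bracket_ge_1 (mode true (k - i))); lra|].
      unfold bracket.
      replace (mode true (k - i)) with (mode sg k - mode sg i)%Z by (unfold mode; lia).
      rewrite minus_IZR; pose proof (Rabs_triang (IZR (mode sg k)) (- IZR (mode sg i))) as h.
      rewrite Rabs_Ropp in h; unfold Rminus; lra.
    + eapply Rle_trans; [apply pow_plus_le; lra|].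
      replace 16 with (4 * 4) by ring; rewrite Rpow_mult_distr, Rmult_assoc.
      apply Rmult_le_compat_l; [apply pow_le; lra|].
      rewrite Rmult_plus_distr_l; apply Rplus_le_compat; apply bracket_pow_le_omega; exact Hmu.
Qed.

(** The two values of [k] are those paired by [zterm]; their modes have absolute value at least [j]
    in both parities. *)
Lemma omega_ge_sq (sg : bool) (m : nat) (mu : R) (j : nat) (k : Z) :
  (1 <= m)%nat -> k = Z.of_nat j \/ k = (- Z.of_nat j - 1)%Z ->
  mu + INR j ^ 2 <= omega sg m mu k.
Proof.
  intros Hm Hk.
  (* Lowering the exponent from [m] to 1 needs a base at least 1, which can fail for [j = 0]. *)
  destruct j as [|j]; [simpl INR; pose proof (omega_ge sg m mu k); nra|].
  unfold omega; rewrite pow_mult.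
  assert (Hn : INR (S j) <= Rabs (IZR (mode sg k))).
  { rewrite INR_IZR_INZ, <- abs_IZR; apply IZR_le; unfold mode; destruct sg; lia. }
  assert (H1 : 1 <= INR (S j)) by (rewrite S_INR; pose proof (pos_INR j); lra).
  pose proof (sq_le_mul_PI (IZR (mode sg k))) as HP.
  pose proof (pow2_abs (IZR (mode sg k))) as HA.
  pose proof (Rle_pow ((IZR (mode sg k) * PI) ^ 2) 1 m ltac:(nra) Hm) as Hp.
  rewrite pow_1 in Hp; nra.
Qed.

(* [1 / ((p+1)^2 + j^2) <= 2 / (p+1+j)^2 <= 2 (1 / (p+j) - 1 / (p+j+1))] telescopes. *)
Lemma box_dual_omega (sg : bool) (m : nat) (p : R) (N : nat) :
  (1 <= m)%nat -> 1 <= p -> box (dual (omega sg m ((p + 1) ^ 2))) N <= 4 / p.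
Proof.
  intros Hm Hp.
  assert (Hj : forall j k, k = Z.of_nat j \/ k = (- Z.of_nat j - 1)%Z ->
            / omega sg m ((p + 1) ^ 2) k <= 2 * (/ (p + INR j) - / (p + INR j + 1))).
  { intros j k Hk.
    pose proof (omega_ge_sq sg m ((p + 1) ^ 2) j k Hm Hk) as H; pose proof (pos_INR j) as Hj0.
    set (t := p + INR j); assert (Ht : 1 <= t) by (unfold t; lra).
    replace (2 * (/ t - / (t + 1))) with (/ (t * (t + 1) / 2)) by (field; lra).
    apply Rinv_le_contravar; [nra|].
    eapply Rle_trans; [|exact H].
    unfold t; pose proof (pow2_ge_0 (p + 1 - INR j)); nra. }
  (* Each [zterm] contains two indices, each costing twice the telescoping difference. *)
  apply Rle_trans with (4 * (/ p - / (p + INR N))).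
  - induction N as [|N IH]; [simpl; rewrite Rplus_0_r; lra|].
    cbn [box]; rewrite S_INR; unfold zterm, dual at 2 3.
    pose proof (Hj N _ (or_introl eq_refl)); pose proof (Hj N _ (or_intror eq_refl)).
    replace (p + (INR N + 1)) with (p + INR N + 1) by ring; lra.
  - pose proof (pos_INR N); assert (0 < / (p + INR N)) by (apply Rinv_0_lt_compat; lra).
    unfold Rdiv; lra.
Qed.

(** * Comparison of [X] and [Y] with the Sobolev spaces *)

Lemma in_H_norm_le (sg : bool) (s : Z) (u : fser) :
  in_H sg s u -> norm_le (weight sg s) u (H_norm sg s u).
Proof. apply (ex_series_norm_le (weight sg s)); apply weight_nonneg. Qed.

Lemma norm_le_in_H (sg : bool) (s : Z) (u : fser) (b : R) : norm_le (weight sg s) u b -> in_H sg s u.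
Proof. apply norm_le_ex_series; apply weight_nonneg. Qed.

Lemma norm_le_H_norm (sg : bool) (s : Z) (u : fser) (b : R) :
  norm_le (weight sg s) u b -> H_norm sg s u <= b.
Proof. apply (nrm_le_of_norm_le (weight sg s)); apply weight_nonneg. Qed.

Lemma norm_le_weight_le_1 (w w' : Z -> R) (u : fser) (b : R) :
  (forall k, w k <= w' k) -> norm_le w' u b -> norm_le w u b.
Proof.
  intros H Hu; rewrite <- (Rmult_1_l b); apply norm_le_weight_le with w'; [lra| |exact Hu].
  intros k; rewrite pow1, Rmult_1_l; apply H.
Qed.

Lemma weight_0 (sg : bool) (k : Z) : weight sg 0 k = 1.
Proof. reflexivity. Qed.

Lemma norm_le_omega_H0 (sg : bool) (m : nat) (mu : R) (u : fser) (b : R) :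
  1 <= mu -> norm_le (omega sg m mu) u b -> norm_le (weight sg 0) u b.
Proof.
  intros Hmu; apply norm_le_weight_le_1; intros k; rewrite weight_0.
  pose proof (omega_ge sg m mu k); lra.
Qed.

Lemma norm_le_H0_dual (sg : bool) (m : nat) (mu : R) (u : fser) (b : R) :
  1 <= mu -> norm_le (weight sg 0) u b -> norm_le (dual (omega sg m mu)) u b.
Proof.
  intros Hmu; apply norm_le_weight_le_1; intros k; rewrite weight_0; unfold dual.
  pose proof (omega_ge sg m mu k); rewrite <- Rinv_1; apply Rinv_le_contravar; lra.
Qed.

Lemma norm_le_omega_in_H (sg : bool) (m : nat) (mu : R) (u : fser) (b : R) :
  1 <= mu -> norm_le (omega sg m mu) u b -> in_H sg (Z.of_nat m) u.
Proof.
  intros Hmu Hu; apply norm_le_in_H with (2 ^ m * b).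
  apply norm_le_weight_le with (omega sg m mu); [apply pow_le; lra| |exact Hu].
  intros k; rewrite weight_nat.
  replace ((2 ^ m) ^ 2) with (4 ^ m)
    by (rewrite <- pow_mult, Nat.mul_comm, pow_mult; f_equal; ring).
  apply bracket_pow_le_omega, Hmu.
Qed.

Lemma in_H_norm_le_omega (sg : bool) (m : nat) (mu : R) (u : fser) :
  0 <= mu -> in_H sg (Z.of_nat m) u -> exists b, norm_le (omega sg m mu) u b.
Proof.
  intros Hmu Hu; exists (sqrt (PI ^ (2 * m) + mu) * H_norm sg (Z.of_nat m) u).
  apply norm_le_weight_le with (weight sg (Z.of_nat m)); [apply sqrt_pos| |apply in_H_norm_le, Hu].
  pose proof (even_pow_nonneg PI m) as HP.
  intros k; rewrite weight_nat, pow2_sqrt by lra; unfold omega.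
  set (n := mode sg k).
  assert (H1 : 1 <= bracket n ^ (2 * m)) by (apply pow_R1_Rle, bracket_ge_1).
  assert (H2 : IZR n ^ (2 * m) <= bracket n ^ (2 * m)).
  { rewrite !pow_mult, <- (pow2_abs (IZR n)); apply pow_incr; split; [apply pow2_ge_0|].
    apply pow_incr; split; [apply Rabs_pos|unfold bracket; lra]. }
  rewrite Rpow_mult_distr; nra.
Qed.

(** * Invertibility and resolvents *)

Definition shifted (sg : bool) (m : nat) (W : fser) (lam : C) (x : fser) : fser :=
  fsub (S_op sg m W x) (fscal lam x).

Definition omega_mul (sg : bool) (m : nat) (mu : R) (x : fser) : fser :=
  fun k => Cmult (RtoC (omega sg m mu k)) (x k).

Lemma shifted_omega (sg : bool) (m : nat) (mu : R) (W : fser) (lam : C) (x : fser) :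
  shifted sg m W lam x
    = fsub (fadd (omega_mul sg m mu x) (mult_op W x)) (fscal (Cplus lam (RtoC mu)) x).
Proof.
  apply functional_extensionality; intros k.
  unfold shifted, fsub, fadd, fscal, S_op, Dpow, omega_mul, omega; rewrite RtoC_plus; ring.
Qed.

Lemma shifted_additive (sg : bool) (m : nat) (mu A : R) (W : fser) (lam : C) :
  1 <= mu -> norm_le (weight true (- Z.of_nat m)) W A ->
  fadditive (omega sg m mu) (shifted sg m W lam).
Proof.
  intros Hmu HW x x' a a' Hx Hx'.
  pose proof (mult_op_sub_r _ _ _ _ _ _ _ _ _ (omega_dominated sg m mu Hmu) HW Hx Hx') as E.
  apply functional_extensionality; intros k; unfold shifted, fscal, S_op, Dpow.
  apply (f_equal (fun g => g k)) in E; unfold fsub at 1; rewrite E.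
  unfold fsub; ring.
Qed.

Lemma omega_mul_sq (sg : bool) (m : nat) (mu : R) (x : fser) (k : Z) :
  1 <= mu ->
  dual (omega sg m mu) k * Cmod (omega_mul sg m mu x k) ^ 2 = omega sg m mu k * Cmod (x k) ^ 2.
Proof.
  intros Hmu; pose proof (omega_ge sg m mu k).
  unfold omega_mul, dual; rewrite Cmod_mult, Cmod_R, Rabs_pos_eq by lra; field; lra.
Qed.

(** The free operator is an isometry of [X] onto [Y], because [omega^2 / omega = omega]; hence the
    constant 1. *)
Lemma omega_mul_invertible (sg : bool) (m : nat) (mu : R) :
  1 <= mu -> invertible (omega sg m mu) (omega_mul sg m mu) 1.
Proof.
  intros Hmu.
  assert (iso : forall x b, norm_le (dual (omega sg m mu)) (omega_mul sg m mu x) b -> norm_le (omega sg m mu) x b).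
  { intros x b [Hb H]; split; [exact Hb|]; intros N.
    erewrite box_ext; [apply (H N)|]; intros k; symmetry; apply omega_mul_sq, Hmu. }
  split.
  - intros y b Hy.
    pose (x := (fun k => Cmult (RtoC (/ omega sg m mu k)) (y k)) : fser).
    assert (E : omega_mul sg m mu x = y).
    { apply functional_extensionality; intros k; unfold omega_mul, x.
      pose proof (omega_ge sg m mu k).
      rewrite Cmult_assoc, <- RtoC_mult, Rinv_r by lra; ring. }
    exists x, b; split; [apply iso; rewrite E; exact Hy|exact E].
  - intros x a b _ H; rewrite Rmult_1_l; apply iso, H.
Qed.

Lemma omega_mul_additive (sg : bool) (m : nat) (mu : R) (w : Z -> R) :
  fadditive w (omega_mul sg m mu).
Proof. intros x x' a a' _ _; apply functional_extensionality; intros k; unfold omega_mul, fsub; ring. Qed.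

Lemma mult_op_additive (sg : bool) (m : nat) (mu A : R) (W : fser) :
  1 <= mu -> norm_le (weight true (- Z.of_nat m)) W A ->
  fadditive (omega sg m mu) (mult_op W).
Proof.
  intros Hmu HW x x' a a' Hx Hx'.
  exact (mult_op_sub_r _ _ _ _ _ _ _ _ _ (omega_dominated sg m mu Hmu) HW Hx Hx').
Qed.

Lemma omega_pos (sg : bool) (m : nat) (mu : R) : 1 <= mu -> forall k, 0 < omega sg m mu k.
Proof. intros Hmu k; pose proof (omega_ge sg m mu k); lra. Qed.

Lemma exists_shift_invertible (sg : bool) (m : nat) (V : fser) :
  (1 <= m)%nat -> in_H true (- Z.of_nat m) V ->
  exists mu S, 1 <= mu /\ (forall N, box (dual (omega sg m mu)) N <= S) /\
    invertible (omega sg m mu) (fun x => fadd (omega_mul sg m mu x) (mult_op V x)) 2.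
Proof.
  intros Hm HV; apply in_H_norm_le in HV.
  set (A := H_norm true (- Z.of_nat m) V) in *.
  assert (HC : 0 < 16 ^ m) by (apply pow_lt; lra).
  (* Smallness asks for [2 * 16^m * (4 / p) * A^2 <= 1/4], that is [p >= 32 * 16^m * A^2]; the added
     1 ensures [p >= 1]. *)
  pose (p := 1 + 32 * 16 ^ m * A ^ 2).
  assert (HA2 : 0 <= 16 ^ m * A ^ 2) by (apply Rmult_le_pos; [lra|apply pow2_ge_0]).
  assert (Hp : 1 <= p) by (unfold p; lra).
  assert (Hmu : 1 <= (p + 1) ^ 2) by nra.
  exists ((p + 1) ^ 2), (4 / p); split; [exact Hmu|split].
  - intros N; apply box_dual_omega; assumption.
  - rewrite <- (Rmult_1_r 2).
    apply neumann with (sqrt (2 * 16 ^ m * (4 / p)) * A).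
    + apply omega_pos, Hmu.
    + lra.
    + rewrite Rmult_1_l; apply Rsqr_incr_0_var; [|lra].
      assert (H4 : 0 < 4 / p) by (apply Rdiv_lt_0_compat; lra).
      rewrite !Rsqr_pow2, Rpow_mult_distr, pow2_sqrt by nra.
      apply Rmult_le_reg_r with p; [lra|].
      replace (2 * 16 ^ m * (4 / p) * A ^ 2 * p) with (8 * (16 ^ m * A ^ 2)) by (field; lra).
      unfold p; lra.
    + apply omega_mul_additive.
    + apply mult_op_additive with A; assumption.
    + apply mult_op_bounded with (weight true (- Z.of_nat m)); [apply omega_dominated, Hmu| |exact HV].
      intros N; apply box_dual_omega; assumption.
    + apply omega_mul_invertible, Hmu.
Qed.

Lemma shifted_in_S_dom (sg : bool) (m : nat) (mu : R) (W : fser) (lam : C) (x : fser) (a b : R) :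
  1 <= mu -> norm_le (omega sg m mu) x a -> norm_le (weight sg 0) (shifted sg m W lam x) b ->
  S_dom sg m W x.
Proof.
  intros Hmu Hx Hb; split; [eapply norm_le_omega_in_H; eassumption|].
  replace (S_op sg m W x) with (fadd (shifted sg m W lam x) (fscal lam x))
    by (unfold shifted; fser_ring).
  apply norm_le_in_H with (b + Cmod lam * a), norm_le_add; [apply weight_nonneg|exact Hb|].
  apply norm_le_scal; [apply weight_nonneg|]; eapply norm_le_omega_H0; eassumption.
Qed.

(* The inverse on the dual space is (A + V)^{-1} + c Res (A + V)^{-1}, where A + V = T + c. *)
Lemma resolvent_invertible (sg : bool) (m : nat) (mu A : R) (V : fser) (lam : C)
    (Res : fser -> fser) :
  1 <= mu -> norm_le (weight true (- Z.of_nat m)) V A ->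
  invertible (omega sg m mu) (fun x => fadd (omega_mul sg m mu x) (mult_op V x)) 2 ->
  is_resolvent sg m V lam Res ->
  exists M, 0 <= M /\ invertible (omega sg m mu) (shifted sg m V lam) M.
Proof.
  intros Hmu HV [Hsurj Hbd] [HR1 [HR2 [M0 HM0]]].
  pose proof (shifted_additive sg m mu A V lam Hmu HV) as HT.
  set (c := Cplus lam (RtoC mu)).
  set (w := omega sg m mu) in *.
  assert (Hw0 : forall k, 0 <= w k) by (intros k; left; apply omega_pos, Hmu).
  assert (HE : forall x, fadd (omega_mul sg m mu x) (mult_op V x)
                         = fadd (shifted sg m V lam x) (fscal c x)).
  { intros x; rewrite (shifted_omega sg m mu); fold c; fser_ring. }
  (* [is_resolvent] puts no sign on its constant, so it is clipped at 0. *)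
  set (M1 := Rmax M0 0).
  assert (HM1 : 0 <= M1) by apply Rmax_r.
  assert (HMR : forall f b, norm_le (weight sg 0) f b -> norm_le (weight sg 0) (Res f) (M1 * b)).
  { intros f b Hf; pose proof (norm_le_in_H _ _ _ _ Hf) as Hin.
    destruct (HR1 f Hin) as [[Hm _] _].
    destruct (in_H_norm_le_omega sg m mu (Res f) ltac:(lra) Hm) as [a Ha].
    apply norm_le_omega_H0 in Ha; [|exact Hmu].
    apply norm_le_mono with (H_norm sg 0 (Res f)); [|apply in_H_norm_le, norm_le_in_H with a, Ha].
    eapply Rle_trans; [apply HM0, Hin|].
    pose proof (norm_le_H_norm _ _ _ _ Hf); pose proof (proj1 (in_H_norm_le _ _ _ Hin)).
    apply Rle_trans with (M1 * H_norm sg 0 f).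
    - apply Rmult_le_compat_r; [assumption|apply Rmax_l].
    - apply Rmult_le_compat_l; assumption. }
  (* With [v = (A + V)^(-1) y] and [z = x - v], the term 2 bounds [v]. The rest bounds [z] by
     [2 (|c v| + |c| |z|)] in L2 norms, where [|c v| <= 2 |c| b] and [|z| <= M1 * 2 |c| b]. *)
  exists (2 + 4 * Cmod c * (1 + M1 * Cmod c)).
  pose proof (Cmod_ge_0 c) as Hc.
  split; [nra|split].
  - intros y b Hy.
    destruct (Hsurj y b Hy) as [v [a [Hv Ev]]].
    rewrite HE in Ev.
    pose (f := fscal (Copp c) v).
    assert (Hf : norm_le (weight sg 0) f (Cmod (Copp c) * a)).
    { apply norm_le_scal; [apply weight_nonneg|]; eapply norm_le_omega_H0; eassumption. }
    destruct (HR1 f (norm_le_in_H _ _ _ _ Hf)) as [[Hm _] Ef].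
    destruct (in_H_norm_le_omega sg m mu (Res f) ltac:(lra) Hm) as [a' Ha'].
    (* Here [T v = y - c v] and [T (Res f) = f = - c v], so the difference is sent to [y]. *)
    exists (fsub v (Res f)), (a + a'); split; [apply norm_le_sub; assumption|].
    rewrite (HT _ _ a a' Hv Ha'); unfold shifted at 2; rewrite Ef, <- Ev; unfold f; fser_ring.
  - intros x a b Hx Hb.
    destruct (Hsurj _ b Hb) as [v [a' [Hv Ev]]].
    assert (Hv2 : norm_le w v (2 * b)) by (apply Hbd with a'; [exact Hv|rewrite Ev; exact Hb]).
    rewrite HE in Ev.
    assert (Hz : norm_le w (fsub x v) (a + a')) by (apply norm_le_sub; assumption).
    assert (Ez : shifted sg m V lam (fsub x v) = fscal c v).
    { rewrite (HT _ _ a a' Hx Hv), <- Ev; fser_ring. }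
    assert (Hcv : norm_le (weight sg 0) (fscal c v) (Cmod c * (2 * b))).
    { apply norm_le_scal; [apply weight_nonneg|]; eapply norm_le_omega_H0; eassumption. }
    (* Although [x] and [v] need not lie in the operator domain, their difference does, as [T] maps
       it to [c v] in L2; so the left inverse property applies. *)
    assert (ER : Res (fscal c v) = fsub x v).
    { rewrite <- Ez; apply HR2.
      eapply shifted_in_S_dom; [exact Hmu|exact Hz|rewrite Ez; exact Hcv]. }
    pose proof (HMR _ _ Hcv) as Hz0; rewrite ER in Hz0.
    (* The gain of regularity: [(T + c) z = c v + c z] is bounded in L2, hence in [Y], and the
       estimate for [T + c] lifts this to a bound of [z] in [X]. *)
    assert (Hz2 : norm_le w (fsub x v) (2 * (Cmod c * (2 * b) + Cmod c * (M1 * (Cmod c * (2 * b)))))).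
    { apply Hbd with (a + a'); [exact Hz|].
      rewrite HE, Ez; apply norm_le_H0_dual; [exact Hmu|].
      apply norm_le_add; [apply weight_nonneg|exact Hcv|].
      apply norm_le_scal; [apply weight_nonneg|exact Hz0]. }
    replace x with (fadd v (fsub x v)) by fser_ring.
    replace ((2 + 4 * Cmod c * (1 + M1 * Cmod c)) * b)
      with (2 * b + 2 * (Cmod c * (2 * b) + Cmod c * (M1 * (Cmod c * (2 * b))))) by ring.
    apply norm_le_add; assumption.
Qed.

Lemma invertible_inj (w : Z -> R) (T : fser -> fser) (M a a' : R) (x x' : fser) :
  (forall k, 0 < w k) -> fadditive w T -> invertible w T M ->
  norm_le w x a -> norm_le w x' a' -> T x = T x' -> x = x'.
Proof.
  intros Hw HT [_ Hbd] Hx Hx' E.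
  apply (norm_le_sub_0_eq w); [exact Hw|].
  rewrite <- (Rmult_0_r M); apply Hbd with (a + a').
  - apply norm_le_sub; [intros k; left; apply Hw|assumption..].
  - rewrite (HT _ _ a a' Hx Hx'), E.
    replace (fsub (T x') (T x')) with fzero by fser_ring.
    apply norm_le_zero; lra.
Qed.

Lemma invertible_ext (w : Z -> R) (T T' : fser -> fser) (M : R) :
  (forall x a, norm_le w x a -> T x = T' x) -> invertible w T M -> invertible w T' M.
Proof.
  intros E [H1 H2]; split.
  - intros y b Hy; destruct (H1 y b Hy) as [x [a [Hx Ex]]].
    exists x, a; split; [exact Hx|]; rewrite <- (E x a Hx); exact Ex.
  - intros x a b Hx Hb; apply H2 with a; [exact Hx|]; rewrite (E x a Hx); exact Hb.
Qed.

(** Choice turns the existence clause of [invertible] into a total function; where no preimage in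
    [X] exists its value is arbitrary. *)
Definition inverse (w : Z -> R) (T : fser -> fser) (f : fser) : fser :=
  epsilon (inhabits fzero) (fun x => (exists a, norm_le w x a) /\ T x = f).

Lemma inverse_spec (w : Z -> R) (T : fser -> fser) (M b : R) (f : fser) :
  invertible w T M -> norm_le (dual w) f b ->
  norm_le w (inverse w T f) (M * b) /\ T (inverse w T f) = f.
Proof.
  intros [H1 H2] Hf.
  assert (H : (exists a, norm_le w (inverse w T f) a) /\ T (inverse w T f) = f).
  { apply (epsilon_spec (inhabits fzero) (fun x => (exists a, norm_le w x a) /\ T x = f)).
    destruct (H1 f b Hf) as [x [a [Hx Ex]]]; exists x; split; [exists a|]; assumption. }
  destruct H as [[a Ha] E]; split; [|exact E].
  apply H2 with a; [exact Ha|rewrite E; exact Hf].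
Qed.

(** Restricting the inverse to L2 keeps the bound [M]. Its values lie in the operator domain because
    [S x = f + lam x] is again in L2, and it is a left inverse by injectivity on [X]. *)
Lemma invertible_resolvent (sg : bool) (m : nat) (mu A M : R) (W : fser) (lam : C) :
  1 <= mu -> norm_le (weight true (- Z.of_nat m)) W A ->
  invertible (omega sg m mu) (shifted sg m W lam) M ->
  is_resolvent sg m W lam (inverse (omega sg m mu) (shifted sg m W lam)).
Proof.
  intros Hmu HW HI.
  pose proof (shifted_additive sg m mu A W lam Hmu HW) as HT.
  assert (Hspec : forall f b, norm_le (weight sg 0) f b ->
    norm_le (omega sg m mu) (inverse (omega sg m mu) (shifted sg m W lam) f) (M * b) /\
    shifted sg m W lam (inverse (omega sg m mu) (shifted sg m W lam) f) = f).
  { intros f b Hf; apply inverse_spec; [exact HI|apply norm_le_H0_dual; assumption]. }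
  split; [|split].
  - intros f Hf; apply in_H_norm_le in Hf.
    destruct (Hspec f _ Hf) as [Hx E]; split; [|exact E].
    eapply shifted_in_S_dom; [exact Hmu|exact Hx|rewrite E; exact Hf].
  - intros u [Hum Hu0].
    destruct (in_H_norm_le_omega sg m mu u ltac:(lra) Hum) as [a Ha].
    assert (Hf : norm_le (weight sg 0) (shifted sg m W lam u) (H_norm sg 0 (S_op sg m W u) + Cmod lam * a)).
    { apply norm_le_sub; [apply weight_nonneg|apply in_H_norm_le, Hu0|].
      apply norm_le_scal; [apply weight_nonneg|eapply norm_le_omega_H0; eassumption]. }
    destruct (Hspec _ _ Hf) as [Hx E].
    exact (invertible_inj _ _ _ _ _ _ _ (omega_pos sg m mu Hmu) HT HI Hx Ha E).
  - exists M; intros f Hf; apply in_H_norm_le in Hf.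
    apply norm_le_H_norm, (norm_le_omega_H0 sg m mu); [exact Hmu|apply Hspec, Hf].
Qed.

Theorem theorem5 (m : nat) (Hm : (1 <= m)%nat) (Vs : nat -> fser) (V : fser)
  (HVs : forall n, in_H true (- Z.of_nat m) (Vs n))
  (HV : in_H true (- Z.of_nat m) V)
  (Hconv : is_lim_seq (fun n => H_norm true (- Z.of_nat m) (fsub (Vs n) V)) 0) :
  forall (sg : bool) (lam : C) (Res : fser -> fser),
    is_resolvent sg m V lam Res ->
    exists Rn : nat -> fser -> fser,
      (exists N : nat, forall n : nat, (N <= n)%nat ->
          is_resolvent sg m (Vs n) lam (Rn n))
      /\ opnorm_conv sg Rn Res.
Proof.
  intros sg lam Res HRes.
  destruct (exists_shift_invertible sg m V Hm HV) as [mu [S [Hmu [HS HI0]]]].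
  assert (HV' := in_H_norm_le _ _ _ HV).
  destruct (resolvent_invertible sg m mu _ V lam Res Hmu HV' HI0 HRes) as [M [HM HI]].
  assert (HVs' := fun n => in_H_norm_le _ _ _ (HVs n)).
  pose proof (shifted_additive sg m mu _ V lam Hmu HV') as HT.
  set (w := omega sg m mu) in *.
  assert (Hw : forall k, 0 < w k) by (apply omega_pos, Hmu).
  assert (Hw0 : forall k, 0 <= w k) by (intros k; left; apply Hw).
  pose (d := fun n => sqrt (2 * 16 ^ m * S) * H_norm true (- Z.of_nat m) (fsub (Vs n) V)).
  pose (B := fun n => mult_op (fsub (Vs n) V)).
  assert (HW : forall n, norm_le (weight true (- Z.of_nat m)) (fsub (Vs n) V)
                            (H_norm true (- Z.of_nat m) (fsub (Vs n) V))).
  { intros n; eapply in_H_norm_le, norm_le_in_H, norm_le_sub; [apply weight_nonneg|apply HVs'|apply HV']. }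
  assert (HB : forall n, fbounded w (B n) (d n)).
  { intros n; apply mult_op_bounded with (weight true (- Z.of_nat m));
      [apply omega_dominated, Hmu|exact HS|apply HW]. }
  assert (Hd : forall e, 0 < e -> exists N, forall n, (N <= n)%nat -> d n < e).
  { intros e He.
    assert (L : is_lim_seq d (sqrt (2 * 16 ^ m * S) * 0)).
    { apply is_lim_seq_mult'; [apply is_lim_seq_const|exact Hconv]. }
    rewrite Rmult_0_r in L; apply is_lim_seq_spec in L.
    destruct (L (mkposreal e He)) as [N HN]; exists N; intros n Hn.
    specialize (HN n Hn); simpl in HN; rewrite Rminus_0_r in HN.
    pose proof (Rle_abs (d n)); lra. }
  assert (Hd0 : forall n, 0 <= d n).
  { intros n; apply Rmult_le_pos; [apply sqrt_pos|apply HW]. }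
  assert (HBE : forall n x a, norm_le w x a ->
            fadd (shifted sg m V lam x) (B n x) = shifted sg m (Vs n) lam x).
  { intros n x a Hx; unfold B.
    rewrite (mult_op_sub_l _ _ _ _ _ _ _ _ _ (omega_dominated sg m mu Hmu) (HVs' n) HV' Hx).
    apply functional_extensionality; intros k; unfold shifted, fadd, fsub, S_op; ring. }
  assert (HIn : forall n, M * d n <= / 2 -> invertible w (shifted sg m (Vs n) lam) (2 * M)).
  { intros n Hn; eapply invertible_ext; [apply (HBE n)|].
    apply neumann with (d n); auto.
    apply mult_op_additive with (H_norm true (- Z.of_nat m) (fsub (Vs n) V)); [exact Hmu|apply HW]. }
  assert (Hev : exists N, forall n, (N <= n)%nat -> M * d n <= / 2).
  (* [M] is only known to be nonnegative, so the threshold divides by [M + 1]. *)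
  { destruct (Hd (/ 2 / (M + 1))) as [N HN]; [apply Rdiv_lt_0_compat; lra|].
    exists N; intros n Hn; specialize (HN n Hn).
    apply Rle_trans with ((M + 1) * d n); [specialize (Hd0 n); nra|].
    apply Rle_trans with ((M + 1) * (/ 2 / (M + 1))); [apply Rmult_le_compat_l; lra|].
    right; field; lra. }
  destruct Hev as [N0 HN0].
  exists (fun n => inverse w (shifted sg m (Vs n) lam)); split.
  - exists N0; intros n Hn; eapply invertible_resolvent; [exact Hmu|apply HVs'|apply HIn, HN0, Hn].
  - intros eps Heps.
    assert (HMM : 0 < 2 * M * M + 1) by nra.
    destruct (Hd (eps / (2 * M * M + 1))) as [N1 HN1]; [apply Rdiv_lt_0_compat; lra|].
    exists (Nat.max N0 N1); intros n Hn f Hf.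
    specialize (HN0 n ltac:(lia)); specialize (HN1 n ltac:(lia)).
    apply in_H_norm_le in Hf; set (b := H_norm sg 0 f) in *.
    destruct (inverse_spec w _ (2 * M) b f (HIn n HN0) (norm_le_H0_dual sg m mu f b Hmu Hf)) as [Hx E].
    set (x := inverse w (shifted sg m (Vs n) lam) f) in *.
    destruct (proj1 HRes f (norm_le_in_H _ _ _ _ Hf)) as [[Hm' _] ER].
    destruct (in_H_norm_le_omega sg m mu (Res f) ltac:(lra) Hm') as [a Ha].
    (* The resolvent identity [T (Res f - x) = B n x] with [x = Rn n f]: the factors are [M] for the
       inverse of [T], [d n] for the perturbation, and [2 * M * b] for [x] in [X]. *)
    apply norm_le_H_norm, norm_le_mono with (M * (d n * (2 * M * b))).
    { replace (M * (d n * (2 * M * b))) with (2 * M * M * d n * b) by ring.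
      apply Rmult_le_compat_r; [apply Hf|].
      apply Rle_trans with ((2 * M * M + 1) * d n); [specialize (Hd0 n); lra|].
      apply Rle_trans with ((2 * M * M + 1) * (eps / (2 * M * M + 1))).
      - apply Rmult_le_compat_l; lra.
      - right; field; lra. }
    apply (norm_le_omega_H0 sg m mu); [exact Hmu|]; apply norm_le_sub_sym.
    apply (proj2 HI) with (a + 2 * M * b); [apply norm_le_sub; assumption|].
    rewrite (HT _ _ a _ Ha Hx).
    replace (fsub (shifted sg m V lam (Res f)) (shifted sg m V lam x)) with (B n x).
    { apply HB, Hx. }
    unfold shifted at 1; rewrite ER, <- E, <- (HBE n x _ Hx); fser_ring.
Qed.
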